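(* Let $M^2$ be a two-dimensional torus with a fixed basis of cycles $a,b$, let $X:M^2\to\mathbb{R}^3$ be a smooth immersion into Euclidean space, and let $\Gamma[X,a,b]\subset(\mathbb{C}\setminus 0)\times(\mathbb{C}\setminus 0)$ be the corresponding Bloch variety (zero-energy dispersion curve of the associated two-dimensional Dirac operator). Then $\Gamma[X,a,b]$ is invariant under conformal transformations of $\mathbb{R}^3$; that is, for every conformal transformation $T$ of $\mathbb{R}^3$ for which no point of $X(M^2)$ is sent to infinity, $\Gamma[T\circ X,a,b]=\Gamma[X,a,b]$.
   Context: Conformal transformations of $\mathbb{R}^3$: the group generated by translations, rotations $A\in SO(3)$, dilations $\vec X\mapsto k\vec X$, reflections $\vec X\mapsto \vec X-2\vec v\langle \vec v,\vec X\rangle$ with $\langle \vec v,\vec v\rangle=1$, and inversions $\vec X\mapsto (\vec X-\vec X_0)/\langle \vec X-\vec X_0,\vec X-\vec X_0\rangle$ (acting on $\mathbb{R}^3\cup\{\infty\}$). Conformal coordinate: the metric induced by $X$ defines a conformal structure on $M^2$. Let $z$ be a global conformal coordinate on the universal cover (so the induced metric is $f(z,\bar z)\,dz\,d\bar z$), normalized so that the shift along $a$ is $z\mapsto z+1$ and the shift along $b$ is $z\mapsto z+\tau$ with $\operatorname{Im}\tau>0$; $z$ is then unique up to shifts $z\mapsto z+d$. Potential (Generalized Weierstrass representation): for a real function $U(z,\bar z)$ let $$L=\begin{pmatrix}\partial_z & -U\\ U&\partial_{\bar z}\end{pmatrix}.$$ In the coordinate $z$ the immersion is represented as $$X_1-iX_2=C_1-iC_2+i\int_{z_0}^z\left(\Psi_2^2\,dz'-\Psi_1^2\,d\bar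 z'\right),\qquad X_3=C_3-\int_{z_0}^z\left(\Psi_2\bar\Psi_1\,dz'+\Psi_1\bar\Psi_2\,d\bar z'\right),$$ with real constants $C_j$ and a solution $\vec\Psi=(\Psi_1,\Psi_2)^T$ of $L\vec\Psi=0$ for a real potential $U$. The potential $U$ is uniquely determined by $X$ and $z$, and is doubly periodic: $U(z+1,\bar z+1)=U(z+\tau,\bar z+\bar\tau)=U(z,\bar z)$. The function $\vec\Psi$ is periodic or anti-periodic under each of the shifts by $1$ and $\tau$. Bloch variety: $\Gamma[U]$ is the set of pairs $(w_1,w_2)\in(\mathbb{C}\setminus0)^2$ for which there exists a non-zero solution $\vec\psi$ of $L\vec\psi=0$ on the $z$-plane with $$\vec\psi(z+1,\bar z+1)=w_1\vec\psi(z,\bar z),\qquad \vec\psi(z+\tau,\bar z+\bar\tau)=w_2\vec\psi(z,\bar z).$$ It does not change under shifts $z\mapsto z+d$, so it depends only on $X,a,b$; by definition $\Gamma[X,a,b]=\Gamma[U]$. *)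

(* Defs.v *)
From Stdlib Require Import Reals.
From Coquelicot Require Import Coquelicot.

Open Scope R_scope.

(** * Smooth functions of two real variables *)

Definition d1 (f : R * R -> R) (p : R * R) : R :=
  Derive (fun t => f (t, snd p)) (fst p).

Definition d2 (f : R * R -> R) (p : R * R) : R :=
  Derive (fun t => f (fst p, t)) (snd p).

Fixpoint Ck (n : nat) (f : R * R -> R) : Prop :=
  match n with
  | O => forall p, continuous f p
  | S m =>
      (forall p, ex_derive (fun t => f (t, snd p)) (fst p)) /\
      (forall p, ex_derive (fun t => f (fst p, t)) (snd p)) /\
      Ck m (d1 f) /\ Ck m (d2 f)
  end.

Definition smooth (f : R * R -> R) : Prop := forall n, Ck n f.

(** [C] is [R * R], so these apply to maps into the plane or into [C], and,
    with [z = x + i y], to functions of [z] as well. *)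

Definition CkC (n : nat) (f : R * R -> C) : Prop :=
  Ck n (fun p => Re (f p)) /\ Ck n (fun p => Im (f p)).

Definition smoothC (f : R * R -> C) : Prop := forall n, CkC n f.

Definition d1C (f : C -> C) (z : C) : C :=
  (d1 (fun q => Re (f q)) z, d1 (fun q => Im (f q)) z).

Definition d2C (f : C -> C) (z : C) : C :=
  (d2 (fun q => Re (f q)) z, d2 (fun q => Im (f q)) z).

Definition d_z (f : C -> C) (z : C) : C := ((d1C f z - Ci * d2C f z) / 2)%C.

Definition d_zbar (f : C -> C) (z : C) : C := ((d1C f z + Ci * d2C f z) / 2)%C.

(** [int (P dz' + Q dzbar')] along the straight segment from [z0] to [z]; it is
    only used for closed forms on the plane, where the path is irrelevant. *)
Definition form_int (P Q : C -> C) (z0 z : C) : C :=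
  RInt (V := C_R_CompleteNormedModule)
    (fun t : R =>
       let w : C := (z0 + RtoC t * (z - z0))%C in
       (P w * (z - z0) + Q w * Cconj (z - z0))%C) 0 1.

(** * Euclidean three-space *)

Record R3 : Set := mk3 { x1 : R; x2 : R; x3 : R }.

Definition add3 (u v : R3) : R3 := mk3 (x1 u + x1 v) (x2 u + x2 v) (x3 u + x3 v).
Definition scal3 (k : R) (u : R3) : R3 := mk3 (k * x1 u) (k * x2 u) (k * x3 u).
Definition sub3 (u v : R3) : R3 := mk3 (x1 u - x1 v) (x2 u - x2 v) (x3 u - x3 v).
Definition zero3 : R3 := mk3 0 0 0.

Definition dot (u v : R3) : R := x1 u * x1 v + x2 u * x2 v + x3 u * x3 v.

Definition cross (u v : R3) : R3 :=
  mk3 (x2 u * x3 v - x3 u * x2 v)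
      (x3 u * x1 v - x1 u * x3 v)
      (x1 u * x2 v - x2 u * x1 v).

Definition d1_3 (X : R * R -> R3) (p : R * R) : R3 :=
  mk3 (d1 (fun q => x1 (X q)) p) (d1 (fun q => x2 (X q)) p) (d1 (fun q => x3 (X q)) p).

Definition d2_3 (X : R * R -> R3) (p : R * R) : R3 :=
  mk3 (d2 (fun q => x1 (X q)) p) (d2 (fun q => x2 (X q)) p) (d2 (fun q => x3 (X q)) p).

(** * Conformal transformations *)

(** The matrix with rows [r1], [r2], [r3] lies in SO(3). *)
Definition is_SO3 (r1 r2 r3 : R3) : Prop :=
  dot r1 r1 = 1 /\ dot r2 r2 = 1 /\ dot r3 r3 = 1 /\
  dot r1 r2 = 0 /\ dot r1 r3 = 0 /\ dot r2 r3 = 0 /\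
  dot (cross r1 r2) r3 = 1.

Definition rotate3 (r1 r2 r3 v : R3) : R3 := mk3 (dot r1 v) (dot r2 v) (dot r3 v).

(** R^3 with a point at infinity, [None]. *)
Definition R3hat : Set := option R3.

Definition fix_infinity (A : R3 -> R3) (P : R3hat) : R3hat := option_map A P.

Definition inversion (X0 : R3) (P : R3hat) : R3hat :=
  match P with
  | Some v =>
      let w := sub3 v X0 in
      if Req_EM_T (dot w w) 0 then None else Some (scal3 (/ dot w w) w)
  | None => Some zero3
  end.

Inductive conformal : (R3hat -> R3hat) -> Prop :=
| conf_translation (v : R3) :
    conformal (fix_infinity (fun X => add3 X v))
| conf_rotation (r1 r2 r3 : R3) :
    is_SO3 r1 r2 r3 -> conformal (fix_infinity (rotate3 r1 r2 r3))
| conf_dilation (k : R) :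
    k <> 0 -> conformal (fix_infinity (scal3 k))
| conf_reflection (v : R3) :
    dot v v = 1 ->
    conformal (fix_infinity (fun X => sub3 X (scal3 (2 * dot v X) v)))
| conf_inversion (X0 : R3) :
    conformal (inversion X0)
| conf_compose (S T : R3hat -> R3hat) :
    conformal S -> conformal T -> conformal (fun P => S (T P))
| conf_inverse (S T : R3hat -> R3hat) :
    conformal T -> (forall P, S (T P) = P) -> (forall P, T (S P) = P) ->
    conformal S.

(** The map [T o X]; the value [zero3] is irrelevant as it is only used when
    [T] sends no [X p] to infinity. *)
Definition compose3 (T : R3hat -> R3hat) (X : R * R -> R3) (p : R * R) : R3 :=
  match T (Some (X p)) with Some v => v | None => zero3 end.

(** * Immersed tori *)

(** A torus with a basis of cycles is given by its universal cover, the plane,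
    on which the two cycles act as the translations by independent vectors [a]
    and [b]; maps from the torus are the maps on the plane invariant under both.
    The orientation of the basis is arbitrary. *)

Definition shift (a p : R * R) : R * R := (fst p + fst a, snd p + snd a).

Definition independent (a b : R * R) : Prop := fst a * snd b - snd a * fst b <> 0.

Definition torus_immersion (a b : R * R) (X : R * R -> R3) : Prop :=
  (forall p, X (shift a p) = X p) /\
  (forall p, X (shift b p) = X p) /\
  smooth (fun p => x1 (X p)) /\ smooth (fun p => x2 (X p)) /\
  smooth (fun p => x3 (X p)) /\
  (forall p (s t : R),
     add3 (scal3 s (d1_3 X p)) (scal3 t (d2_3 X p)) = zero3 -> s = 0 /\ t = 0).

(** [z] is a global conformal coordinate on the universal cover, with inverse
    [zi], normalized along the two cycles; [fun q => X (zi q)] is the immersion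
    written in this coordinate, and its metric is [f dz dzbar]. *)
Definition conformal_coordinate (a b : R * R) (X : R * R -> R3) (tau : C)
    (z : R * R -> C) (zi : C -> R * R) : Prop :=
  smoothC z /\ smoothC zi /\
  (forall p, zi (z p) = p) /\ (forall q, z (zi q) = q) /\
  0 < Im tau /\
  (forall p, z (shift a p) = (z p + 1)%C) /\
  (forall p, z (shift b p) = (z p + tau)%C) /\
  exists f : C -> R, forall q,
    let Xx := d1_3 (fun q' => X (zi q')) q in
    let Xy := d2_3 (fun q' => X (zi q')) q in
    0 < f q /\ dot Xx Xx = f q /\ dot Xy Xy = f q /\ dot Xx Xy = 0.

(** * The Dirac operator and the Bloch variety *)

Definition dirac (U : C -> R) (psi : C -> C * C) (z : C) : C * C :=
  ((d_z (fun q => fst (psi q)) z - RtoC (U z) * snd (psi z))%C,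
   (RtoC (U z) * fst (psi z) + d_zbar (fun q => snd (psi q)) z)%C).

(** Classical solutions of [L psi = 0] on the whole plane. *)
Definition dirac_solution (U : C -> R) (psi : C -> C * C) : Prop :=
  CkC 1 (fun q => fst (psi q)) /\ CkC 1 (fun q => snd (psi q)) /\
  forall q, dirac U psi q = (RtoC 0, RtoC 0).

(** [U] is the potential of the conformal immersion [Y] of the plane, in its
    generalized Weierstrass representation. *)
Definition is_potential (Y : C -> R3) (U : C -> R) : Prop :=
  exists (Psi : C -> C * C) (z0 : C) (C1 C2 C3 : R),
    dirac_solution U Psi /\
    let Psi1 := fun q => fst (Psi q) in
    let Psi2 := fun q => snd (Psi q) in
    forall z : C,
      (RtoC (x1 (Y z)) - Ci * RtoC (x2 (Y z)) =
         RtoC C1 - Ci * RtoC C2 +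
         Ci * form_int (fun q => Psi2 q * Psi2 q)
                       (fun q => - (Psi1 q * Psi1 q)) z0 z)%C /\
      (RtoC (x3 (Y z)) =
         RtoC C3 -
         form_int (fun q => Psi2 q * Cconj (Psi1 q))
                  (fun q => Psi1 q * Cconj (Psi2 q)) z0 z)%C.

(** Gamma[U], for the periods [1] and [tau]. *)
Definition bloch_variety_potential (tau : C) (U : C -> R) (w : C * C) : Prop :=
  fst w <> RtoC 0 /\ snd w <> RtoC 0 /\
  exists psi : C -> C * C,
    dirac_solution U psi /\
    (exists q, psi q <> (RtoC 0, RtoC 0)) /\
    (forall q, psi (q + 1)%C =
       ((fst w * fst (psi q))%C, (fst w * snd (psi q))%C)) /\
    (forall q, psi (q + tau)%C =
       ((snd w * fst (psi q))%C, (snd w * snd (psi q))%C)).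

(** Gamma[X,a,b].  The coordinate exists and is unique up to a shift, which also
    determines [tau], and [U] is then determined; so this is Gamma[U] for any
    admissible choice. *)
Definition bloch_variety (a b : R * R) (X : R * R -> R3) (w : C * C) : Prop :=
  exists (tau : C) (z : R * R -> C) (zi : C -> R * R) (U : C -> R),
    conformal_coordinate a b X tau z zi /\
    is_potential (fun q => X (zi q)) U /\
    bloch_variety_potential tau U w.

(* Main.v *)
Require Import Defs.
From Stdlib Require Import Reals Lra Classical.
From Coquelicot Require Import Coquelicot.

Open Scope R_scope.

(** A conformal transformation is a similarity or a similarity after one inversion, so the
    potential only has to be followed through similarities and an inversion avoiding the surface.
    Translations, dilations and rotations (lifted to the quaternions acting on the Weierstrass
    spinor [Psi]) do not change [U], and [X -> - X] replaces [U] by [- U].  An inversion is a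
    Moutard-Darboux transformation: with [j (a, b) = (bbar, - abar)] and [S] the symmetric matrix
    of primitives of the closed forms [omega (psi, phi) = psi2 phi2 dz - psi1 phi1 dzbar] on
    [Psi, j Psi], whose entries are the coordinates of the surface and [- det S = |X|^2], the
    columns of [(Psi, j Psi) S^-1] are the spinors of the inverted surface, and
      [psi -> psi - (Psi, j Psi) S^-1 F],   [dF = (omega (psi, Psi), omega (psi, j Psi))],
    maps solutions for [U] to solutions for the new potential.  If the multiplier of [psi] is not
    the multiplier [(+-1, +-1)] of [Psi], the constants in [F] can be chosen so that the multiplier
    is preserved, and the image is non-zero because otherwise [psi] would be a constant combination
    of [Psi] and [j Psi].  If it is the multiplier of [Psi], then the spinor of the inverted surface
    itself has this multiplier. *)

(** * Continuously differentiable functions of two variables *)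

(** The partial derivatives are explicit arguments, so that the calculus rules below produce
    formulas that [ring] and [field] can compare. *)
Definition C1R (f fx fy : R * R -> R) : Prop :=
  (forall p, is_derive (fun t => f (t, snd p)) (fst p) (fx p)) /\
  (forall p, is_derive (fun t => f (fst p, t)) (snd p) (fy p)) /\
  (forall p, continuous fx p) /\ (forall p, continuous fy p).

Lemma C1R_filterdiff (f fx fy : R * R -> R) (p : R * R) :
  C1R f fx fy ->
  filterdiff f (locally p) (fun u => plus (scal (fst u) (fx p)) (scal (snd u) (fy p))).
Proof.
  destruct p as [x y]. intros (Hx & Hy & Cx & Cy).
  apply filterdiff_ext with (fun u : R * R => f (fst u, snd u)).
  { intros [u v]; reflexivity. }
  apply (is_derive_filterdiff (fun u v => f (u, v)) x y (fun u v => fx (u, v)) (fy (x, y))).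
  - apply filter_forall. intros u. generalize (Hx u). now destruct u.
  - exact (Hy (x, y)).
  - apply continuous_ext with fx; [now intros [u v] | apply Cx].
Qed.

Lemma C1R_continuous (f fx fy : R * R -> R) (p : R * R) : C1R f fx fy -> continuous f p.
Proof.
  intros H.
  apply (filterdiff_continuous (K := R_AbsRing)
    (U := prod_NormedModule R_AbsRing R_NormedModule R_NormedModule) (V := R_NormedModule)).
  eexists. exact (C1R_filterdiff f fx fy p H).
Qed.

Lemma C1R_ext (f g fx gx fy gy : R * R -> R) :
  (forall p, f p = g p) -> (forall p, fx p = gx p) -> (forall p, fy p = gy p) ->
  C1R f fx fy -> C1R g gx gy.
Proof.
  intros E Ex Ey (Hx & Hy & Cx & Cy). refine (conj _ (conj _ (conj _ _))); intros p.
  - rewrite <- Ex. apply is_derive_ext with (2 := Hx p). intros; apply E.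
  - rewrite <- Ey. apply is_derive_ext with (2 := Hy p). intros; apply E.
  - apply continuous_ext with (1 := Ex). apply Cx.
  - apply continuous_ext with (1 := Ey). apply Cy.
Qed.

Lemma C1R_const (c : R) : C1R (fun _ => c) (fun _ => 0) (fun _ => 0).
Proof.
  refine (conj _ (conj _ (conj _ _))); intros p; try apply (is_derive_const (V := R_NormedModule));
    apply continuous_const.
Qed.

Lemma C1R_plus (f g fx gx fy gy : R * R -> R) :
  C1R f fx fy -> C1R g gx gy ->
  C1R (fun p => f p + g p) (fun p => fx p + gx p) (fun p => fy p + gy p).
Proof.
  intros (Hx & Hy & Cx & Cy) (Gx & Gy & Dx & Dy). refine (conj _ (conj _ (conj _ _))); intros p.
  - apply (is_derive_plus (V := R_NormedModule)); auto.
  - apply (is_derive_plus (V := R_NormedModule)); auto.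
  - apply (continuous_plus (V := R_NormedModule)); auto.
  - apply (continuous_plus (V := R_NormedModule)); auto.
Qed.

Lemma C1R_opp (f fx fy : R * R -> R) :
  C1R f fx fy -> C1R (fun p => - f p) (fun p => - fx p) (fun p => - fy p).
Proof.
  intros (Hx & Hy & Cx & Cy). refine (conj _ (conj _ (conj _ _))); intros p.
  - apply (is_derive_opp (V := R_NormedModule)); auto.
  - apply (is_derive_opp (V := R_NormedModule)); auto.
  - apply (continuous_opp (V := R_NormedModule)); auto.
  - apply (continuous_opp (V := R_NormedModule)); auto.
Qed.

Lemma C1R_mult (f g fx gx fy gy : R * R -> R) :
  C1R f fx fy -> C1R g gx gy ->
  C1R (fun p => f p * g p) (fun p => fx p * g p + f p * gx p)
      (fun p => fy p * g p + f p * gy p).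
Proof.
  intros F G.
  assert (Cf := fun p => C1R_continuous f fx fy p F).
  assert (Cg := fun p => C1R_continuous g gx gy p G).
  destruct F as (Hx & Hy & Cx & Cy), G as (Gx & Gy & Dx & Dy).
  refine (conj _ (conj _ (conj _ _))); intros p.
  - generalize (is_derive_mult (K := R_AbsRing) _ _ _ _ _ (Hx p) (Gx p) Rmult_comm). now destruct p.
  - generalize (is_derive_mult (K := R_AbsRing) _ _ _ _ _ (Hy p) (Gy p) Rmult_comm). now destruct p.
  - apply (continuous_plus (V := R_NormedModule));
      apply (continuous_mult (K := R_AbsRing)); auto.
  - apply (continuous_plus (V := R_NormedModule));
      apply (continuous_mult (K := R_AbsRing)); auto.
Qed.

Lemma C1R_inv (f fx fy : R * R -> R) :
  (forall p, f p <> 0) -> C1R f fx fy ->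
  C1R (fun p => / f p) (fun p => - fx p * (/ f p * / f p)) (fun p => - fy p * (/ f p * / f p)).
Proof.
  intros N F.
  assert (Cf : forall p, continuous (fun q => / f q) p).
  { intros p. apply continuous_comp. apply (C1R_continuous f fx fy p F).
    apply continuous_Rinv, N. }
  destruct F as (Hx & Hy & Cx & Cy).
  refine (conj _ (conj _ (conj _ _))); intros p.
  - replace (- fx p * (/ f p * / f p)) with (- fx p / f p ^ 2) by (field; apply N).
    generalize (is_derive_inv _ _ _ (Hx p)). destruct p as [x y]. intros H; apply H, (N (x, y)).
  - replace (- fy p * (/ f p * / f p)) with (- fy p / f p ^ 2) by (field; apply N).
    generalize (is_derive_inv _ _ _ (Hy p)). destruct p as [x y]. intros H; apply H, (N (x, y)).
  - apply (continuous_mult (K := R_AbsRing)).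
    + apply (continuous_opp (V := R_NormedModule)); auto.
    + apply (continuous_mult (K := R_AbsRing)); auto.
  - apply (continuous_mult (K := R_AbsRing)).
    + apply (continuous_opp (V := R_NormedModule)); auto.
    + apply (continuous_mult (K := R_AbsRing)); auto.
Qed.

Lemma C1R_unique (f fx fy gx gy : R * R -> R) (p : R * R) :
  C1R f fx fy -> C1R f gx gy -> fx p = gx p /\ fy p = gy p.
Proof.
  intros (Hx & Hy & _) (Gx & Gy & _). split.
  - rewrite <- (is_derive_unique _ _ _ (Hx p)). apply is_derive_unique, Gx.
  - rewrite <- (is_derive_unique _ _ _ (Hy p)). apply is_derive_unique, Gy.
Qed.

Lemma continuous_shift (f : R * R -> R) (a p : R * R) :
  (forall q, continuous f q) -> continuous (fun q => f (fst q + fst a, snd q + snd a)) p.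
Proof.
  intros Cf.
  apply (continuous_comp_2 (fun q : R * R => fst q + fst a) (fun q : R * R => snd q + snd a) (fun x y => f (x, y))).
  - apply (continuous_plus (V := R_NormedModule)); [apply continuous_fst | apply continuous_const].
  - apply (continuous_plus (V := R_NormedModule)); [apply continuous_snd | apply continuous_const].
  - apply continuous_ext with f; [now intros [u v] | apply Cf].
Qed.

Lemma C1R_shift (f fx fy : R * R -> R) (a : R * R) :
  C1R f fx fy ->
  C1R (fun p => f (fst p + fst a, snd p + snd a)) (fun p => fx (fst p + fst a, snd p + snd a))
      (fun p => fy (fst p + fst a, snd p + snd a)).
Proof.
  intros (Hx & Hy & Cx & Cy). refine (conj _ (conj _ (conj _ _))); intros p; try now apply continuous_shift.
  - generalize (is_derive_comp (V := R_NormedModule)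
      (fun t => f (t, snd p + snd a)) (fun t => t + fst a) (fst p)
      (fx (fst p + fst a, snd p + snd a)) 1 (Hx (fst p + fst a, snd p + snd a))).
    unfold scal; simpl; unfold mult; simpl. rewrite Rmult_1_l. intros H; apply H.
    auto_derive; trivial.
  - generalize (is_derive_comp (V := R_NormedModule)
      (fun t => f (fst p + fst a, t)) (fun t => t + snd a) (snd p)
      (fy (fst p + fst a, snd p + snd a)) 1 (Hy (fst p + fst a, snd p + snd a))).
    unfold scal; simpl; unfold mult; simpl. rewrite Rmult_1_l. intros H; apply H.
    auto_derive; trivial.
Qed.

Lemma continuous_segment (g : R * R -> R) (p v : R * R) (t : R) :
  (forall q, continuous g q) ->
  continuous (fun s : R => g (fst p + s * fst v, snd p + s * snd v)) t.
Proof.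
  intros Cg.
  apply (continuous_comp_2 (fun s : R => fst p + s * fst v) (fun s : R => snd p + s * snd v) (fun x y => g (x, y))).
  - apply (ex_derive_continuous (V := R_NormedModule)). auto_derive; trivial.
  - apply (ex_derive_continuous (V := R_NormedModule)). auto_derive; trivial.
  - apply continuous_ext with g; [now intros [x y] | apply Cg].
Qed.

(** The fundamental theorem of calculus for [f] restricted to the segment from [p] to [p + v]; by
    total differentiability the derivative there is the differential of [f] applied to [v]. *)
Lemma C1R_segment (f fx fy : R * R -> R) (p v : R * R) :
  C1R f fx fy ->
  is_RInt (fun t => fx (fst p + t * fst v, snd p + t * snd v) * fst v
                    + fy (fst p + t * fst v, snd p + t * snd v) * snd v) 0 1
          (f (fst p + fst v, snd p + snd v) - f p).
Proof.
  intros F.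
  set (g := fun t => f (fst p + t * fst v, snd p + t * snd v)).
  replace (f (fst p + fst v, snd p + snd v) - f p) with (minus (g 1) (g 0) : R).
  2:{ unfold g, minus, plus, opp; simpl. rewrite !Rmult_1_l, !Rmult_0_l, !Rplus_0_r.
      now destruct p. }
  apply (is_RInt_derive (V := R_CompleteNormedModule)); intros t _.
  - unfold g.
    assert (D := C1R_filterdiff f fx fy (fst p + t * fst v, snd p + t * snd v) F).
    unfold is_derive.
    set (w := (fst p + t * fst v, snd p + t * snd v)) in *.
    assert (E : filterdiff (fun s : R => (fst p + s * fst v, snd p + s * snd v)) (locally t)
                  (fun h : R => (h * fst v, h * snd v))).
    { set (P := fun x y : R => (x, y)).
      apply (filterdiff_comp'_2 (K := R_AbsRing)
        (T := R_NormedModule) (U := R_NormedModule) (V := R_NormedModule)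
        (W := prod_NormedModule R_AbsRing R_NormedModule R_NormedModule)
        (fun s : R => fst p + s * fst v)
        (fun s : R => snd p + s * snd v) P t
        (fun h => h * fst v) (fun h => h * snd v) P).
      - change (is_derive (fun s => fst p + s * fst v) t (fst v)). auto_derive; trivial. ring.
      - change (is_derive (fun s => snd p + s * snd v) t (snd v)). auto_derive; trivial. ring.
      - apply filterdiff_ext with (fun u : R * R => u). { intros [? ?]; reflexivity. }
        apply filterdiff_ext_lin with (fun u : R * R => u). apply filterdiff_id. intros [? ?]; reflexivity. }
    generalize (filterdiff_comp' (K := R_AbsRing) (U := R_NormedModule)
       (V := prod_NormedModule R_AbsRing R_NormedModule R_NormedModule) (W := R_NormedModule)
       _ f t _ _ E D).
    intros H. apply filterdiff_ext_lin with (1 := H). intros h.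
    unfold plus, scal; simpl; unfold mult; simpl. ring.
  - destruct F as (_ & _ & Cx & Cy).
    apply (continuous_plus (V := R_NormedModule));
    apply (continuous_mult (K := R_AbsRing)); try apply continuous_const; now apply continuous_segment.
Qed.

Lemma C1R_constant (f : R * R -> R) (p q : R * R) :
  C1R f (fun _ => 0) (fun _ => 0) -> f p = f q.
Proof.
  intros F. generalize (C1R_segment _ _ _ p (fst q - fst p, snd q - snd p) F). simpl.
  replace (fst p + (fst q - fst p)) with (fst q) by ring.
  replace (snd p + (snd q - snd p)) with (snd q) by ring.
  rewrite <- surjective_pairing. intros H.
  apply (is_RInt_unique (V := R_CompleteNormedModule)) in H.
  rewrite (RInt_const (V := R_CompleteNormedModule)) in H.
  unfold scal in H; simpl in H; unfold mult in H; simpl in H. lra.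
Qed.

(* The primitive is integrated along the path [(x0, y0) -> (x, y0) -> (x, y)]. *)
Lemma closed_form_primitive (g gx gy h hx hy : R * R -> R) :
  C1R g gx gy -> C1R h hx hy -> (forall p, gy p = hx p) ->
  exists f, C1R f g h.
Proof.
  intros G H E.
  assert (Cg := fun p => C1R_continuous _ _ _ p G).
  assert (Ch := fun p => C1R_continuous _ _ _ p H).
  assert (Ch' : forall x y, continuous (fun s => h (x, s)) y).
  { intros x y. apply continuous_ext with (fun s => h (fst (x, 0) + s * fst (0, 1), snd (x, 0) + s * snd (0, 1))).
    { intros s; simpl; f_equal; f_equal; ring. }
    now apply continuous_segment. }
  assert (Cg' : forall x y, continuous (fun s => g (s, y)) x).
  { intros x y. apply continuous_ext with (fun s => g (fst (0, y) + s * fst (1, 0), snd (0, y) + s * snd (1, 0))).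
    { intros s; simpl; f_equal; f_equal; ring. }
    now apply continuous_segment. }
  assert (Cgy' : forall x y, continuous (fun s => gy (x, s)) y).
  { intros x y. apply continuous_ext with (fun s => gy (fst (x, 0) + s * fst (0, 1), snd (x, 0) + s * snd (0, 1))).
    { intros s; simpl; f_equal; f_equal; ring. }
    apply continuous_segment, G. }
  exists (fun p => RInt (fun s => g (s, 0)) 0 (fst p) + RInt (fun s => h (fst p, s)) 0 (snd p)).
  split; [|split; [|split; assumption]]; intros [x y]; cbn [fst snd].
  (* The first integral contributes [g (x, 0)]. Differentiating the second under the integral sign
     and using [hx = gy] contributes [g (x, y) - g (x, 0)]. *)
  - replace (g (x, y)) with (g (x, 0) + (g (x, y) - g (x, 0))) by ring.
    apply (is_derive_plus (V := R_NormedModule)).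
    + apply (is_derive_RInt (V := R_NormedModule) (fun s => g (s, 0)) _ 0 x).
      * apply filter_forall. intros b. apply (RInt_correct (V := R_CompleteNormedModule)).
        apply (ex_RInt_continuous (V := R_CompleteNormedModule)). intros z _. apply Cg'.
      * apply Cg'.
    + replace (g (x, y) - g (x, 0)) with (RInt (fun t => Derive (fun u => h (u, t)) x) 0 y).
      * apply is_derive_RInt_param.
        -- apply filter_forall. intros u t _. exists (hx (u, t)). apply (proj1 H (u, t)).
        -- intros t _. apply continuity_2d_pt_filterlim.
           assert (D : forall u v, Derive (fun z => h (z, v)) u = hx (u, v)).
           { intros u v. apply is_derive_unique, (proj1 H (u, v)). }
           rewrite D. apply filterlim_ext with hx. { intros [u v]. now rewrite D. }
           apply H.
        -- apply filter_forall. intros u.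
           apply (ex_RInt_continuous (V := R_CompleteNormedModule)). intros z _. apply Ch'.
      * apply (is_RInt_unique (V := R_CompleteNormedModule)).
        apply is_RInt_ext with (fun t => gy (x, t)).
        { intros t _. rewrite E. symmetry. apply is_derive_unique, (proj1 H (x, t)). }
        apply (is_RInt_derive (V := R_CompleteNormedModule) (fun t => g (x, t))); intros t _.
        -- apply (proj1 (proj2 G) (x, t)).
        -- apply Cgy'.
  -  replace (h (x, y)) with (0 + h (x, y)) by ring.
    apply (is_derive_plus (V := R_NormedModule)).
    + apply (is_derive_const (V := R_NormedModule)).
    + apply (is_derive_RInt (V := R_NormedModule) (fun s => h (x, s)) _ 0 y).
      * apply filter_forall. intros b. apply (RInt_correct (V := R_CompleteNormedModule)).
        apply (ex_RInt_continuous (V := R_CompleteNormedModule)). intros z _. apply Ch'.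
      * apply Ch'.
Qed.

(** * Wirtinger derivatives *)

(** [A] and [B] are the derivatives of [f] in z and zbar: the real and imaginary parts of f_x = A +
    B and f_y = i (A - B) are spelled out. *)
Definition wirtinger (f A B : C -> C) : Prop :=
  C1R (fun z => Re (f z)) (fun z => Re (A z) + Re (B z)) (fun z => Im (B z) - Im (A z)) /\
  C1R (fun z => Im (f z)) (fun z => Im (A z) + Im (B z)) (fun z => Re (A z) - Re (B z)).

Lemma wirtinger_ext (f g A A' B B' : C -> C) :
  (forall z, f z = g z) -> (forall z, A z = A' z) -> (forall z, B z = B' z) ->
  wirtinger f A B -> wirtinger g A' B'.
Proof.
  intros E EA EB [F1 F2]. split.
  - apply C1R_ext with (4 := F1); intros; now rewrite <- ?E, <- ?EA, <- ?EB.
  - apply C1R_ext with (4 := F2); intros; now rewrite <- ?E, <- ?EA, <- ?EB.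
Qed.

Lemma wirtinger_const (c : C) : wirtinger (fun _ => c) (fun _ => RtoC 0) (fun _ => RtoC 0).
Proof.
  split; (eapply C1R_ext; [| | | apply C1R_const]); intros; simpl; try reflexivity; ring.
Qed.

Lemma wirtinger_plus (f g A A' B B' : C -> C) :
  wirtinger f A B -> wirtinger g A' B' ->
  wirtinger (fun z => f z + g z)%C (fun z => A z + A' z)%C (fun z => B z + B' z)%C.
Proof.
  intros [F1 F2] [G1 G2]. split.
  - apply C1R_ext with (4 := C1R_plus _ _ _ _ _ _ F1 G1); intros; simpl; unfold Re, Im; ring.
  - apply C1R_ext with (4 := C1R_plus _ _ _ _ _ _ F2 G2); intros; simpl; unfold Re, Im; ring.
Qed.

Lemma wirtinger_mult (f g A A' B B' : C -> C) :
  wirtinger f A B -> wirtinger g A' B' ->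
  wirtinger (fun z => f z * g z)%C (fun z => A z * g z + f z * A' z)%C
            (fun z => B z * g z + f z * B' z)%C.
Proof.
  intros [F1 F2] [G1 G2]. split.
  - apply C1R_ext with (4 := C1R_plus _ _ _ _ _ _ (C1R_mult _ _ _ _ _ _ F1 G1)
      (C1R_opp _ _ _ (C1R_mult _ _ _ _ _ _ F2 G2))); intros; simpl; unfold Re, Im; ring.
  - apply C1R_ext with (4 := C1R_plus _ _ _ _ _ _ (C1R_mult _ _ _ _ _ _ F1 G2)
      (C1R_mult _ _ _ _ _ _ F2 G1)); intros; simpl; unfold Re, Im; ring.
Qed.

Lemma wirtinger_scal (c : C) (f A B : C -> C) :
  wirtinger f A B -> wirtinger (fun z => c * f z)%C (fun z => c * A z)%C (fun z => c * B z)%C.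
Proof.
  intros F. apply wirtinger_ext with (4 := wirtinger_mult _ _ _ _ _ _ (wirtinger_const c) F);
    intros; ring.
Qed.

Lemma wirtinger_conj (f A B : C -> C) :
  wirtinger f A B ->
  wirtinger (fun z => Cconj (f z)) (fun z => Cconj (B z)) (fun z => Cconj (A z)).
Proof.
  intros [F1 F2]. split.
  - apply C1R_ext with (4 := F1); intros; simpl; unfold Re, Im; ring.
  - apply C1R_ext with (4 := C1R_opp _ _ _ F2); intros; simpl; unfold Re, Im; ring.
Qed.

Lemma normsq_pos (c : C) : c <> RtoC 0 -> 0 < Re c * Re c + Im c * Im c.
Proof.
  destruct c as [x y]; simpl. intros H.
  destruct (Req_dec x 0) as [-> | Hx].
  - destruct (Req_dec y 0) as [-> | Hy]; [now destruct H | nra].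
  - nra.
Qed.

Lemma wirtinger_inv (f A B : C -> C) :
  (forall z, f z <> RtoC 0) -> wirtinger f A B ->
  wirtinger (fun z => / f z)%C (fun z => - A z * (/ f z * / f z))%C
            (fun z => - B z * (/ f z * / f z))%C.
Proof.
  intros N [F1 F2].
  assert (N' : forall z, Re (f z) * Re (f z) + Im (f z) * Im (f z) <> 0).
  { intros z. generalize (normsq_pos _ (N z)). lra. }
  assert (I := C1R_inv _ _ _ N' (C1R_plus _ _ _ _ _ _ (C1R_mult _ _ _ _ _ _ F1 F1)
                                   (C1R_mult _ _ _ _ _ _ F2 F2))).
  split.
  - apply C1R_ext with (4 := C1R_mult _ _ _ _ _ _ F1 I); intros z; generalize (N' z);
      unfold Re, Im; destruct (f z), (A z), (B z); simpl; intros; field; lra.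
  - apply C1R_ext with (4 := C1R_opp _ _ _ (C1R_mult _ _ _ _ _ _ F2 I)); intros z; generalize (N' z);
      unfold Re, Im; destruct (f z), (A z), (B z); simpl; intros; field; lra.
Qed.

Lemma wirtinger_unique (f A B A' B' : C -> C) (z : C) :
  wirtinger f A B -> wirtinger f A' B' -> A z = A' z /\ B z = B' z.
Proof.
  intros [F1 F2] [G1 G2].
  destruct (C1R_unique _ _ _ _ _ z F1 G1), (C1R_unique _ _ _ _ _ z F2 G2).
  split; apply injective_projections; unfold Re, Im in *; lra.
Qed.

Lemma wirtinger_shift (f A B : C -> C) (c : C) :
  wirtinger f A B ->
  wirtinger (fun z => f (z + c)%C) (fun z => A (z + c)%C) (fun z => B (z + c)%C).
Proof.
  intros [F1 F2]. split.
  - exact (C1R_shift _ _ _ c F1).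
  - exact (C1R_shift _ _ _ c F2).
Qed.

Lemma wirtinger_constant (f : C -> C) (z w : C) :
  wirtinger f (fun _ => RtoC 0) (fun _ => RtoC 0) -> f z = f w.
Proof.
  intros [F1 F2]. apply injective_projections.
  - apply (C1R_constant (fun z => Re (f z)) z w).
    apply C1R_ext with (4 := F1); intros; simpl; ring.
  - apply (C1R_constant (fun z => Im (f z)) z w).
    apply C1R_ext with (4 := F2); intros; simpl; ring.
Qed.

Lemma wirtinger_form_int (f P Q : C -> C) (z0 z : C) :
  wirtinger f P Q -> form_int P Q z0 z = (f z - f z0)%C.
Proof.
  intros [F1 F2]. unfold form_int. apply (is_RInt_unique (V := C_R_CompleteNormedModule)).
  assert (E : forall t : R, (z0 + RtoC t * (z - z0))%C =
            (fst z0 + t * fst (z - z0)%C, snd z0 + t * snd (z - z0)%C)).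
  { intros t. apply injective_projections; simpl; ring. }
  assert (E1 : (fst z0 + fst (z - z0)%C, snd z0 + snd (z - z0)%C) = z).
  { apply injective_projections; simpl; ring. }
  apply (is_RInt_fct_extend_pair (U := R_NormedModule) (V := R_NormedModule)).
  - generalize (C1R_segment _ _ _ z0 (z - z0)%C F1). rewrite E1.
    apply is_RInt_ext. intros t _. cbv beta zeta. rewrite <- E.
    destruct (P (z0 + RtoC t * (z - z0))%C), (Q (z0 + RtoC t * (z - z0))%C). simpl. ring.
  - generalize (C1R_segment _ _ _ z0 (z - z0)%C F2). rewrite E1.
    apply is_RInt_ext. intros t _. cbv beta zeta. rewrite <- E.
    destruct (P (z0 + RtoC t * (z - z0))%C), (Q (z0 + RtoC t * (z - z0))%C). simpl. ring.
Qed.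

(** The condition is closedness of P dz + Q dzbar; its real and imaginary parts are closed real
    forms and are integrated separately. *)
Lemma wirtinger_primitive (P Pz Pzb Q Qz Qzb : C -> C) :
  wirtinger P Pz Pzb -> wirtinger Q Qz Qzb -> (forall z, Pzb z = Qz z) ->
  exists f, wirtinger f P Q.
Proof.
  intros [P1 P2] [Q1 Q2] E.
  destruct (closed_form_primitive _ _ _ _ _ _
    (C1R_plus _ _ _ _ _ _ P1 Q1) (C1R_plus _ _ _ _ _ _ Q2 (C1R_opp _ _ _ P2))) as [f1 F1].
  { intros z. rewrite E. ring. }
  destruct (closed_form_primitive _ _ _ _ _ _
    (C1R_plus _ _ _ _ _ _ P2 Q2) (C1R_plus _ _ _ _ _ _ P1 (C1R_opp _ _ _ Q1))) as [f2 F2].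
  { intros z. rewrite E. ring. }
  exists (fun z => (f1 z, f2 z)). split.
  - apply C1R_ext with (4 := F1); intros; simpl; ring.
  - apply C1R_ext with (4 := F2); intros; simpl; ring.
Qed.

(** * Comparison with [Ck], [d_z], [d_zbar] and the Dirac equation *)

Lemma C1R_of_Ck (f : R * R -> R) : Ck 1 f -> C1R f (Defs.d1 f) (Defs.d2 f).
Proof.
  intros (D1 & D2 & C1 & C2). split; [|split; [|split; assumption]]; intros p.
  - apply Derive_correct, D1.
  - apply Derive_correct, D2.
Qed.

Lemma C1R_partials (f fx fy : R * R -> R) (p : R * R) :
  C1R f fx fy -> Defs.d1 f p = fx p /\ Defs.d2 f p = fy p.
Proof.
  intros (D1 & D2 & _). split; apply is_derive_unique; [apply D1 | apply D2].
Qed.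

Lemma Ck_of_C1R (f fx fy : R * R -> R) : C1R f fx fy -> Ck 1 f.
Proof.
  intros F. assert (E := fun p => C1R_partials _ _ _ p F). destruct F as (D1 & D2 & C1 & C2).
  split; [|split; [|split]]; intros p.
  - eexists; apply D1.
  - eexists; apply D2.
  - apply continuous_ext with fx; [intros q; symmetry; apply E | apply C1].
  - apply continuous_ext with fy; [intros q; symmetry; apply E | apply C2].
Qed.

Lemma wirtinger_of_CkC (f : C -> C) : CkC 1 f -> wirtinger f (d_z f) (d_zbar f).
Proof.
  intros [F1 F2]. split.
  - apply C1R_ext with (4 := C1R_of_Ck _ F1); intros p; simpl; unfold Re, Im; simpl; field.
  - apply C1R_ext with (4 := C1R_of_Ck _ F2); intros p; simpl; unfold Re, Im; simpl; field.
Qed.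

Lemma CkC_of_wirtinger (f A B : C -> C) : wirtinger f A B -> CkC 1 f.
Proof. intros [F1 F2]. split; eapply Ck_of_C1R; eassumption. Qed.

Lemma wirtinger_partials (f A B : C -> C) (z : C) :
  wirtinger f A B -> d_z f z = A z /\ d_zbar f z = B z.
Proof.
  intros F. exact (wirtinger_unique f _ _ _ _ z
    (wirtinger_of_CkC f (CkC_of_wirtinger _ _ _ F)) F).
Qed.

Lemma Cminus_eq (x y : C) : (x - y)%C = RtoC 0 -> x = y.
Proof. intros H. replace x with (x - y + y)%C by ring. rewrite H. ring. Qed.

Lemma Cplus_eq_0 (x y : C) : (x + y)%C = RtoC 0 -> y = (- x)%C.
Proof. intros H. replace y with (x + y - x)%C by ring. rewrite H. ring. Qed.

Lemma dirac_solution_wirtinger (U : C -> R) (psi : C -> C * C) :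
  dirac_solution U psi <->
  exists P Q : C -> C,
    wirtinger (fun q => fst (psi q)) (fun q => RtoC (U q) * snd (psi q))%C P /\
    wirtinger (fun q => snd (psi q)) Q (fun q => - (RtoC (U q) * fst (psi q)))%C.
Proof.
  split.
  - intros (F1 & F2 & E).
    exists (d_zbar (fun q => fst (psi q))), (d_z (fun q => snd (psi q))). split.
    + apply wirtinger_ext with (4 := wirtinger_of_CkC _ F1); intros q; try reflexivity.
      exact (Cminus_eq _ _ (f_equal fst (E q))).
    + apply wirtinger_ext with (4 := wirtinger_of_CkC _ F2); intros q; try reflexivity.
      apply Cplus_eq_0. exact (f_equal snd (E q)).
  - intros (P & Q & F1 & F2). split; [|split].
    + now apply CkC_of_wirtinger in F1.
    + now apply CkC_of_wirtinger in F2.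
    + intros q. unfold dirac.
      rewrite (proj1 (wirtinger_partials _ _ _ q F1)), (proj2 (wirtinger_partials _ _ _ q F2)).
      cbv beta. f_equal; ring.
Qed.

(** * Weierstrass representations and their Bloch spectra *)

(** The Dirac equation prescribes one Wirtinger derivative of each component; the other two only
    have to exist and be continuous. *)
Definition spinor (U : C -> R) (a b : C -> C) : Prop :=
  (exists P, wirtinger a (fun q => RtoC (U q) * b q)%C P) /\
  (exists Q, wirtinger b Q (fun q => - (RtoC (U q) * a q))%C).

(* [i (X1 - i X2)] *)
Definition planar (v : R3) : C := (x2 v, x1 v).

(** The Weierstrass formulas in differential form: after multiplying the first by i, the base point
    and the constants of integration disappear. *)
Definition weierstrass (Y : C -> R3) (U : C -> R) (a b : C -> C) : Prop :=
  spinor U a b /\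
  wirtinger (fun z => planar (Y z)) (fun z => - (b z * b z))%C (fun z => a z * a z)%C /\
  wirtinger (fun z => RtoC (x3 (Y z))) (fun z => - (b z * Cconj (a z)))%C
            (fun z => - (a z * Cconj (b z)))%C.

Lemma spinor_ext (U U' : C -> R) (a b a' b' : C -> C) :
  (forall z, U z = U' z) -> (forall z, a z = a' z) -> (forall z, b z = b' z) ->
  spinor U a b -> spinor U' a' b'.
Proof.
  intros E Ea Eb [[P F] [Q G]]. split; [exists P | exists Q].
  - apply wirtinger_ext with (4 := F); intros z; now rewrite <- ?E, <- ?Ea, <- ?Eb.
  - apply wirtinger_ext with (4 := G); intros z; now rewrite <- ?E, <- ?Ea, <- ?Eb.
Qed.

Lemma dirac_solution_spinor (U : C -> R) (psi : C -> C * C) :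
  dirac_solution U psi <-> spinor U (fun q => fst (psi q)) (fun q => snd (psi q)).
Proof.
  rewrite dirac_solution_wirtinger. split.
  - intros (P & Q & F & G). split; eexists; eassumption.
  - intros [[P F] [Q G]]. exists P, Q. now split.
Qed.

Lemma RtoC_m1 : RtoC (-1) = (- RtoC 1)%C.
Proof. apply injective_projections; simpl; ring. Qed.

(** These are [omega] of [(p, q)] with [(a, b)] and with [j (a, b)]. For the first, both mixed
    derivatives equal - U (p b + q a); for the second, realness of [U] is used when the equations of
    [a] and [b] are conjugated. *)
Lemma spinor_forms_closed (U : C -> R) (a b p q : C -> C) :
  spinor U a b -> spinor U p q ->
  (exists f, wirtinger f (fun z => q z * b z)%C (fun z => - (p z * a z))%C) /\
  (exists f, wirtinger f (fun z => - (q z * Cconj (a z)))%C (fun z => - (p z * Cconj (b z)))%C).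
Proof.
  intros [[Pa Fa] [Qb Fb]] [[Pp Fp] [Qq Fq]]. split.
  - eapply wirtinger_primitive.
    + apply wirtinger_mult; eassumption.
    + apply wirtinger_ext with (4 := wirtinger_scal (RtoC (-1)) _ _ _ (wirtinger_mult _ _ _ _ _ _ Fp Fa)).
      * intros z. cbv beta. rewrite RtoC_m1. ring.
      * intros z. reflexivity.
      * intros z. reflexivity.
    + intros z. cbv beta. rewrite RtoC_m1. ring.
  - assert (G := wirtinger_conj _ _ _ Fa). assert (H := wirtinger_conj _ _ _ Fb).
    eapply wirtinger_primitive.
    + apply wirtinger_ext with (4 := wirtinger_scal (RtoC (-1)) _ _ _ (wirtinger_mult _ _ _ _ _ _ Fq G)).
      * intros z. cbv beta. rewrite RtoC_m1. ring.
      * intros z. reflexivity.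
      * intros z. reflexivity.
    + apply wirtinger_ext with (4 := wirtinger_scal (RtoC (-1)) _ _ _ (wirtinger_mult _ _ _ _ _ _ Fp H)).
      * intros z. cbv beta. rewrite RtoC_m1. ring.
      * intros z. reflexivity.
      * intros z. reflexivity.
    + intros z. cbv beta.
      rewrite Copp_conj, !Cmult_conj, RtoC_m1.
      replace (Cconj (RtoC (U z))) with (RtoC (U z)).
      ring. apply injective_projections; simpl; ring.
Qed.

(** Pairing the spinor with itself in [spinor_forms_closed] gives primitives of the Weierstrass
    forms, so the segment integrals are differences of primitives and can be differentiated.
    Conversely the base point 0 and the coordinates of [Y] there serve as constants. *)
Lemma is_potential_weierstrass (Y : C -> R3) (U : C -> R) :
  is_potential Y U <-> exists a b, weierstrass Y U a b.
Proof.
  split.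
  - intros (Psi & z0 & C1 & C2 & C3 & D & E).
    apply dirac_solution_spinor in D.
    set (a := fun q => fst (Psi q)) in *. set (b := fun q => snd (Psi q)) in *.
    exists a, b. split; [exact D|].
    destruct (spinor_forms_closed U a b a b D D) as [[f Hf] [g Hg]].
    split.
    + eapply wirtinger_ext; [| | |
        apply wirtinger_plus; [apply (wirtinger_const (C2, C1)) |
          apply (wirtinger_scal (RtoC (-1))); apply wirtinger_plus;
           [exact Hf | apply (wirtinger_const (- f z0)%C)]]].
      * intros z. destruct (E z) as [E1 _]. cbv zeta in E1.
        rewrite (wirtinger_form_int f (fun q => b q * b q)%C (fun q => - (a q * a q))%C z0 z Hf) in E1.
        generalize (f_equal fst E1) (f_equal snd E1).
        unfold planar. destruct (f z), (f z0). simpl. intros H1 H2.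
        apply injective_projections; simpl; lra.
      * intros z. cbv beta. rewrite RtoC_m1. ring.
      * intros z. cbv beta. rewrite RtoC_m1. ring.
    + eapply wirtinger_ext; [| | |
        apply wirtinger_plus; [apply (wirtinger_const (RtoC C3)) |
          apply wirtinger_plus;
           [exact Hg | apply (wirtinger_const (- g z0)%C)]]].
      * intros z. destruct (E z) as [_ E1]. cbv zeta in E1.
        rewrite (wirtinger_form_int (fun z => (RtoC (-1)) * g z)%C (fun q => b q * Cconj (a q))%C (fun q => (a q * Cconj (b q)))%C z0 z) in E1.
        -- rewrite E1, RtoC_m1. ring.
        -- apply wirtinger_ext with (4 := wirtinger_scal (RtoC (-1)) _ _ _ Hg).
           reflexivity.
           intros w. cbv beta. rewrite RtoC_m1. ring.
           intros w. cbv beta. rewrite RtoC_m1. ring.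
      * intros z. cbv beta. ring.
      * intros z. cbv beta. ring.
  - intros (a & b & D & K & T).
    exists (fun z => (a z, b z)), (RtoC 0), (x1 (Y (RtoC 0))), (x2 (Y (RtoC 0))), (x3 (Y (RtoC 0))).
    split; [now apply dirac_solution_spinor|]. cbn [fst snd]. intros z. split.
    + rewrite (wirtinger_form_int (fun z => (RtoC (-1)) * planar (Y z))%C).
      * apply injective_projections; simpl; ring.
      * apply wirtinger_ext with (4 := wirtinger_scal (RtoC (-1)) _ _ _ K).
        reflexivity.
        intros w. cbv beta. rewrite RtoC_m1. ring.
        intros w. cbv beta. rewrite RtoC_m1. ring.
    + rewrite (wirtinger_form_int (fun z => (RtoC (-1)) * RtoC (x3 (Y z)))%C).
      * apply injective_projections; simpl; ring.
      * apply wirtinger_ext with (4 := wirtinger_scal (RtoC (-1)) _ _ _ T).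
        reflexivity.
        intros w. cbv beta. rewrite RtoC_m1. ring.
        intros w. cbv beta. rewrite RtoC_m1. ring.
Qed.

(** |a|^2 + |b|^2, whose square is the conformal factor; it is positive exactly where the surface is
    immersed. *)
Definition spinor_density (a b : C) : R := Re a * Re a + Im a * Im a + Re b * Re b + Im b * Im b.

Lemma weierstrass_metric (Y : C -> R3) (U : C -> R) (a b : C -> C) (z : C) :
  weierstrass Y U a b ->
  let s := spinor_density (a z) (b z) in
  dot (d1_3 Y z) (d1_3 Y z) = s * s /\ dot (d2_3 Y z) (d2_3 Y z) = s * s /\
  dot (d1_3 Y z) (d2_3 Y z) = 0.
Proof.
  intros (_ & [K1 K2] & [T1 _]).
  assert (H2 := C1R_partials _ _ _ z K1). assert (H1 := C1R_partials _ _ _ z K2).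
  assert (H3 := C1R_partials _ _ _ z T1).
  unfold dot, d1_3, d2_3; cbn [x1 x2 x3].
  cbn [Re Im planar fst snd RtoC] in H1, H2, H3.
  rewrite (proj1 H1), (proj2 H1), (proj1 H2), (proj2 H2), (proj1 H3), (proj2 H3).
  unfold spinor_density. destruct (a z) as [a1 a2], (b z) as [b1 b2]. simpl.
  split; [|split]; ring.
Qed.

(** * Bloch spectra under translations and linear conformal maps *)

Definition quasi (tau : C) (w : C * C) (f : C -> C) : Prop :=
  forall z, f (z + 1)%C = (fst w * f z)%C /\ f (z + tau)%C = (snd w * f z)%C.

Definition bloch_spectrum (tau : C) (U : C -> R) (w : C * C) : Prop :=
  fst w <> RtoC 0 /\ snd w <> RtoC 0 /\
  exists p q, spinor U p q /\ (exists z, ~ (p z = RtoC 0 /\ q z = RtoC 0)) /\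
    quasi tau w p /\ quasi tau w q.

Lemma bloch_variety_potential_spectrum (tau : C) (U : C -> R) (w : C * C) :
  bloch_variety_potential tau U w <-> bloch_spectrum tau U w.
Proof.
  split; intros (N1 & N2 & H); (split; [exact N1 | split; [exact N2 |]]).
  - destruct H as (psi & D & [z N] & P1 & P2).
    exists (fun z => fst (psi z)), (fun z => snd (psi z)). split; [|split; [|split]].
    + now apply dirac_solution_spinor.
    + exists z. intros [E1 E2]. apply N. now apply injective_projections.
    + intros q. now rewrite P1, P2.
    + intros q. now rewrite P1, P2.
  - destruct H as (p & q & D & [z N] & P & Q). exists (fun z => (p z, q z)). split; [|split; [|split]].
    + now apply dirac_solution_spinor.
    + exists z. intros E. apply N. split; [exact (f_equal fst E) | exact (f_equal snd E)].
    + intros r. cbn [fst snd]. now rewrite (proj1 (P r)), (proj1 (Q r)).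
    + intros r. cbn [fst snd]. now rewrite (proj2 (P r)), (proj2 (Q r)).
Qed.

(** The statement carried through every transformation. Periodicity and positive density are part of
    it because together they force the multipliers of the Weierstrass spinor to be signs, which the
    inversion step needs. *)
Definition in_bloch (tau : C) (Y : C -> R3) (w : C * C) : Prop :=
  (forall z, Y (z + 1)%C = Y z /\ Y (z + tau)%C = Y z) /\
  exists U a b, weierstrass Y U a b /\ (forall z, 0 < spinor_density (a z) (b z)) /\
    bloch_spectrum tau U w.

Lemma in_bloch_ext (tau : C) (Y Y' : C -> R3) (w : C * C) :
  (forall z, Y z = Y' z) -> in_bloch tau Y w -> in_bloch tau Y' w.
Proof.
  intros E (P & U & a & b & (D & K & T) & N & B). split.
  - intros z. rewrite <- !E. apply P.
  - exists U, a, b. split; [|now split]. split; [exact D|]. split.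
    + apply wirtinger_ext with (4 := K); intros z; now rewrite <- ?E.
    + apply wirtinger_ext with (4 := T); intros z; now rewrite <- ?E.
Qed.

Lemma in_bloch_translation (tau : C) (Y : C -> R3) (w : C * C) (v : R3) :
  in_bloch tau Y w -> in_bloch tau (fun z => add3 (Y z) v) w.
Proof.
  intros (P & U & a & b & (D & K & T) & N & B). split.
  - intros z. now rewrite (proj1 (P z)), (proj2 (P z)).
  - exists U, a, b. split; [|now split]. split; [exact D|]. split.
    + apply wirtinger_ext with (4 := wirtinger_plus _ _ _ _ _ _ K (wirtinger_const (planar v)));
        intros z; try reflexivity; apply Cplus_0_r.
    + apply wirtinger_ext with (4 := wirtinger_plus _ _ _ _ _ _ T (wirtinger_const (RtoC (x3 v))));
        intros z; try apply Cplus_0_r.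
      cbn [add3 x3]. now rewrite RtoC_plus.
Qed.

(* The quaternionic action [Psi -> alpha Psi + beta j Psi], [j (a, b) = (bbar, - abar)],
   covers the conformal linear maps. *)
Definition spin_rotation (al be : C) (v : R3) : R3 :=
  let k := (al * al * planar v - (RtoC 2 * (al * be)) * RtoC (x3 v)
            - be * be * Cconj (planar v))%C in
  mk3 (Im k) (Re k)
      ((Re al * Re al + Im al * Im al - Re be * Re be - Im be * Im be) * x3 v
       + 2 * Re (al * Cconj be * planar v)%C).

Lemma RtoC_conj (x : R) : Cconj (RtoC x) = RtoC x.
Proof. apply injective_projections; simpl; ring. Qed.

(** Since [U] is real, [j] maps solutions to solutions, so alpha Psi + beta j Psi solves the same
    equation. The potential and its spectrum are untouched, and the density is multiplied by
    |alpha|^2 + |beta|^2. *)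
Lemma in_bloch_spin_rotation (tau : C) (Y : C -> R3) (w : C * C) (al be : C) :
  0 < spinor_density al be ->
  in_bloch tau Y w -> in_bloch tau (fun z => spin_rotation al be (Y z)) w.
Proof.
  intros Nab (P & U & a & b & ([[Pa Fa] [Qb Fb]] & K & T) & N & B). split.
  - intros z. now rewrite (proj1 (P z)), (proj2 (P z)).
  - assert (Fac := wirtinger_conj _ _ _ Fa). assert (Fbc := wirtinger_conj _ _ _ Fb).
    assert (Kc := wirtinger_conj _ _ _ K).
    exists U, (fun z => al * a z + be * Cconj (b z))%C, (fun z => al * b z - be * Cconj (a z))%C.
    split; [|split; [|exact B]].
    + split; [split|split].
      * eexists. eapply wirtinger_ext; [| | |
          apply wirtinger_plus; [apply (wirtinger_scal al); exact Fa | apply (wirtinger_scal be); exact Fbc]];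
          intros z; cbv beta; try reflexivity.
        rewrite Copp_conj, Cmult_conj, RtoC_conj. ring.
      * eexists. eapply wirtinger_ext; [| | |
          apply wirtinger_plus; [apply (wirtinger_scal al); exact Fb |
             apply (wirtinger_scal (- be)%C); exact Fac]];
          intros z; cbv beta; try reflexivity.
        -- ring.
        -- rewrite Cmult_conj, RtoC_conj. ring.
      * eapply wirtinger_ext; [| | |
          apply wirtinger_plus; [apply (wirtinger_scal (al * al)%C); exact K |
           apply wirtinger_plus;
             [apply (wirtinger_scal (- (RtoC 2 * (al * be)))%C); exact T
             |apply (wirtinger_scal (- (be * be))%C); exact Kc]]];
          intros z; cbv beta.
        -- apply injective_projections; simpl; ring.
        -- rewrite ?Copp_conj, ?Cmult_conj. ring.
        -- rewrite ?Copp_conj, ?Cmult_conj. ring.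
      * eapply wirtinger_ext; [| | |
          apply wirtinger_plus; [apply (wirtinger_scal (al * Cconj al - be * Cconj be)%C); exact T |
           apply wirtinger_plus;
             [apply (wirtinger_scal (al * Cconj be)%C); exact K
             |apply (wirtinger_scal (Cconj al * be)%C); exact Kc]]];
          intros z; cbv beta.
        -- apply injective_projections; simpl; unfold Re, Im; simpl; ring.
        -- rewrite ?Cplus_conj, ?Copp_conj, ?Cmult_conj, ?Cconj_conj. ring.
        -- rewrite ?Cminus_conj, ?Copp_conj, ?Cmult_conj, ?Cconj_conj. ring.
    + intros z. replace (spinor_density _ _) with (spinor_density al be * spinor_density (a z) (b z)).
      * apply Rmult_lt_0_compat; auto.
      * unfold spinor_density, Re, Im; simpl; ring.
Qed.

(** The surface is quadratic in the spinor, so the quaternion [sqrt k] scales it by [k]. *)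
Lemma in_bloch_dilation_pos (tau : C) (Y : C -> R3) (w : C * C) (k : R) :
  0 < k -> in_bloch tau Y w -> in_bloch tau (fun z => scal3 k (Y z)) w.
Proof.
  intros Hk H. assert (Hs := sqrt_lt_R0 k Hk). assert (E := sqrt_sqrt k (Rlt_le _ _ Hk)).
  set (s := sqrt k) in *. clearbody s. subst k.
  apply in_bloch_ext with (2 := in_bloch_spin_rotation tau Y w (RtoC s) (RtoC 0)
    ltac:(unfold spinor_density; simpl; nra) H).
  intros z. unfold spin_rotation, scal3. destruct (Y z). f_equal; simpl; ring.
Qed.

(* The antipodal map reverses the sign of the potential. *)
Lemma in_bloch_antipode (tau : C) (Y : C -> R3) (w : C * C) :
  in_bloch tau Y w -> in_bloch tau (fun z => scal3 (-1) (Y z)) w.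
Proof.
  intros (P & U & a & b & ([[Pa Fa] [Qb Fb]] & K & T) & N & N1 & N2 & p & q & S & Nz & Mp & Mq).
  split.
  - intros z. now rewrite (proj1 (P z)), (proj2 (P z)).
  (* The factors i and - i reverse the signs of a^2, b^2 and b abar, hence of the surface, and turn
     the equation for [U] into the one for [- U]. *)
  - exists (fun z => - U z), (fun z => Ci * a z)%C, (fun z => - Ci * b z)%C.
    split; [|split].
    + split; [split|split].
      * eexists. eapply wirtinger_ext; [| | | apply (wirtinger_scal Ci), Fa]; intros z; cbv beta; try reflexivity.
        rewrite RtoC_opp. ring.
      * eexists. eapply wirtinger_ext; [| | | apply (wirtinger_scal (- Ci)%C), Fb]; intros z; cbv beta; try reflexivity.
        rewrite RtoC_opp. ring.
      * eapply wirtinger_ext; [| | | apply (wirtinger_scal (RtoC (-1))), K]; intros z; cbv beta;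
          apply injective_projections; simpl; ring.
      * eapply wirtinger_ext; [| | | apply (wirtinger_scal (RtoC (-1))), T]; intros z; cbv beta;
          apply injective_projections; simpl; ring.
    + intros z. generalize (N z). unfold spinor_density. destruct (a z), (b z). simpl. lra.
    (* Changing the sign of the second component of a solution for [U] gives a solution for [- U]
       with the same multipliers. *)
    + split; [exact N1 | split; [exact N2 |]]. exists p, (fun z => RtoC (-1) * q z)%C.
      destruct S as [[Pp Fp] [Qq Fq]]. split; [split|split; [|split]].
      * eexists. eapply wirtinger_ext; [| | | exact Fp]; intros z; cbv beta; try reflexivity.
        rewrite ?RtoC_m1, ?RtoC_opp. ring.
      * eexists. eapply wirtinger_ext; [| | | apply (wirtinger_scal (RtoC (-1))), Fq]; intros z; cbv beta; try reflexivity.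
        rewrite ?RtoC_m1, ?RtoC_opp. ring.
      * destruct Nz as [z Nz]. exists z. intros [Ep Eq]. apply Nz. split; [exact Ep|].
        replace (q z) with (RtoC (-1) * (RtoC (-1) * q z))%C.
        rewrite Eq; ring. rewrite RtoC_m1; ring.
      * exact Mp.
      * intros z. rewrite (proj1 (Mq z)), (proj2 (Mq z)). split; ring.
Qed.

(** * Inversions *)

(* [(c1, c2) = S^-1 (f1, f2)] for [S = ((- k, t), (t, - m))].  The conjugates [ab], [bb] of [a], [b]
   and [m] of [- k] are treated as independent functions, so that all identities are rational. *)
Lemma inversion_coefficients (a b ab bb k m t f1 f2 p q : C -> C) :
  wirtinger k (fun z => - (b z * b z))%C (fun z => a z * a z)%C ->
  wirtinger m (fun z => - (ab z * ab z))%C (fun z => bb z * bb z)%C ->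
  wirtinger t (fun z => - (b z * ab z))%C (fun z => - (a z * bb z))%C ->
  wirtinger f1 (fun z => q z * b z)%C (fun z => - (p z * a z))%C ->
  wirtinger f2 (fun z => - (q z * ab z))%C (fun z => - (p z * bb z))%C ->
  (forall z, t z * t z - k z * m z <> RtoC 0)%C ->
  let n := (fun z => t z * t z - k z * m z)%C in
  let c1 := (fun z => (m z * f1 z + t z * f2 z) / n z)%C in
  let c2 := (fun z => (t z * f1 z + k z * f2 z) / n z)%C in
  let p' := (fun z => p z - c1 z * a z - c2 z * bb z)%C in
  let q' := (fun z => q z - c1 z * b z + c2 z * ab z)%C in
  wirtinger c1 (fun z => (m z * b z - t z * ab z) / n z * q' z)%C
               (fun z => - ((m z * a z + t z * bb z) / n z * p' z))%C /\
  wirtinger c2 (fun z => (t z * b z - k z * ab z) / n z * q' z)%C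
               (fun z => - ((t z * a z + k z * bb z) / n z * p' z))%C.
Proof.
  intros K M T F1 F2 N n c1 c2 p' q'.
  assert (Hn : wirtinger n (fun z => - RtoC 2 * t z * (b z * ab z) + b z * b z * m z + k z * (ab z * ab z))%C
                (fun z => - RtoC 2 * t z * (a z * bb z) - a z * a z * m z - k z * (bb z * bb z))%C).
  { unfold n. eapply wirtinger_ext; [| | | apply wirtinger_plus;
      [apply wirtinger_mult; [exact T | exact T]
      |apply (wirtinger_scal (RtoC (-1))); apply wirtinger_mult; [exact K | exact M]]];
    intros z; cbv beta; rewrite RtoC_m1; ring. }
  assert (Hi := wirtinger_inv n _ _ N Hn).
  split.
  - eapply wirtinger_ext; [| | | apply wirtinger_mult;
      [apply wirtinger_plus; apply wirtinger_mult; [exact M | exact F1 | exact T | exact F2] | exact Hi]];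
    intros z; cbv beta; [reflexivity | |];
    unfold q', p', c1, c2, n; field; apply N.
  - eapply wirtinger_ext; [| | | apply wirtinger_mult;
      [apply wirtinger_plus; apply wirtinger_mult; [exact T | exact F1 | exact K | exact F2] | exact Hi]];
    intros z; cbv beta; [reflexivity | |];
    unfold q', p', c1, c2, n; field; apply N.
Qed.

(* The inversion itself has the opposite orientation: it is this reflected map that is represented
   by a column of [(Psi, j Psi) S^-1]. *)
Definition mirror_inversion (v : R3) : R3 :=
  mk3 (x1 v / dot v v) (- (x2 v / dot v v)) (x3 v / dot v v).

(** The first column of [(Psi, j Psi) S^-1], where [S] has k = [planar v], t = [x3 v] and m = - conj
    k, so that - det S = |v|^2; [inverted_spinor2] is its lower entry. *)
Definition inverted_spinor1 (v : R3) (a b : C) : C :=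
  ((- Cconj (planar v) * a + RtoC (x3 v) * Cconj b) / RtoC (dot v v))%C.

Definition inverted_spinor2 (v : R3) (a b : C) : C :=
  ((- Cconj (planar v) * b - RtoC (x3 v) * Cconj a) / RtoC (dot v v))%C.

(** The correction is what multiplies [q'] when [p'] is differentiated in [darboux_transform]. The
    expression under [Re] is already real where [Y] does not vanish. *)
Definition inverted_potential (Y : C -> R3) (U : C -> R) (a b : C -> C) (z : C) : R :=
  U z - Re (inverted_spinor2 (Y z) (a z) (b z) * a z
            + Cconj (inverted_spinor1 (Y z) (a z) (b z)) * Cconj (b z))%C.

(** [darboux_c1] and [darboux_c2] are the components of [S^-1 F] for F = (f1, f2). *)
Definition darboux_c1 (v : R3) (f1 f2 : C) : C :=
  ((- Cconj (planar v) * f1 + RtoC (x3 v) * f2) / RtoC (dot v v))%C.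

Definition darboux_c2 (v : R3) (f1 f2 : C) : C :=
  ((RtoC (x3 v) * f1 + planar v * f2) / RtoC (dot v v))%C.

Lemma dot_planar (v : R3) :
  RtoC (dot v v) = (RtoC (x3 v) * RtoC (x3 v) - planar v * - Cconj (planar v))%C.
Proof. apply injective_projections; unfold dot; simpl; ring. Qed.

(** With k = [planar (Y z)] and t = [x3 (Y z)], the subtracted term is t (|b|^2 - |a|^2) - 2 Re
    (conj k a b) over |Y|^2, which is real. *)
Lemma inverted_potential_correct (Y : C -> R3) (U : C -> R) (a b : C -> C) (z : C) :
  dot (Y z) (Y z) <> 0 ->
  RtoC (inverted_potential Y U a b z) =
    (RtoC (U z) - (inverted_spinor2 (Y z) (a z) (b z) * a z
            + Cconj (inverted_spinor1 (Y z) (a z) (b z)) * Cconj (b z)))%C.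
Proof.
  intros N. unfold inverted_potential, inverted_spinor1, inverted_spinor2.
  unfold dot in *. apply injective_projections; simpl.
  - unfold Re; simpl. reflexivity.
  - destruct (a z), (b z). simpl. field. exact N.
Qed.

(** The z-derivatives of [c1] and [c2] are multiples of [q'] and their zbar-derivatives multiples of
    [p']. So the derivatives of [p'] and [q'] close up into a Dirac equation, and if [p'] and [q']
    vanish identically then [c1] and [c2] are constant. *)
Lemma darboux_transform (Y : C -> R3) (U : C -> R) (a b p q f1 f2 : C -> C) :
  weierstrass Y U a b -> (forall z, dot (Y z) (Y z) <> 0) -> spinor U p q ->
  wirtinger f1 (fun z => q z * b z)%C (fun z => - (p z * a z))%C ->
  wirtinger f2 (fun z => - (q z * Cconj (a z)))%C (fun z => - (p z * Cconj (b z)))%C ->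
  let c1 := (fun z => darboux_c1 (Y z) (f1 z) (f2 z)) in
  let c2 := (fun z => darboux_c2 (Y z) (f1 z) (f2 z)) in
  let p' := (fun z => p z - c1 z * a z - c2 z * Cconj (b z))%C in
  let q' := (fun z => q z - c1 z * b z + c2 z * Cconj (a z))%C in
  spinor (inverted_potential Y U a b) p' q' /\
  ((forall z, p' z = RtoC 0 /\ q' z = RtoC 0) ->
     forall z w, c1 z = c1 w /\ c2 z = c2 w).
Proof.
  intros ([[Pa Fa] [Qb Fb]] & K & T) N [[Pp Fp] [Qq Fq]] F1 F2 c1 c2 p' q'.
  assert (Nc : forall z, RtoC (dot (Y z) (Y z)) <> RtoC 0).
  { intros z H. apply (N z). exact (f_equal fst H). }
  assert (M := wirtinger_scal (RtoC (-1)) _ _ _ (wirtinger_conj _ _ _ K)).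
  destruct (inversion_coefficients a b (fun z => Cconj (a z)) (fun z => Cconj (b z))
    (fun z => planar (Y z)) (fun z => - Cconj (planar (Y z)))%C (fun z => RtoC (x3 (Y z)))
    f1 f2 p q) as [H1 H2]; try assumption.
  { apply wirtinger_ext with (4 := M); intros z; cbv beta; rewrite RtoC_m1, ?Copp_conj, ?Cmult_conj; ring. }
  { intros z. rewrite <- dot_planar. apply Nc. }
  assert (G1 : wirtinger c1 (fun z => inverted_spinor2 (Y z) (a z) (b z) * q' z)%C
            (fun z => - (inverted_spinor1 (Y z) (a z) (b z) * p' z))%C).
  { apply wirtinger_ext with (4 := H1); intros z; cbv beta;
      unfold inverted_spinor1, inverted_spinor2, p', q', c1, c2, darboux_c1, darboux_c2;
      rewrite dot_planar; reflexivity. }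
  assert (G2 : wirtinger c2 (fun z => Cconj (inverted_spinor1 (Y z) (a z) (b z)) * q' z)%C
            (fun z => Cconj (inverted_spinor2 (Y z) (a z) (b z)) * p' z)%C).
  { apply wirtinger_ext with (4 := H2); intros z; cbv beta;
      unfold inverted_spinor1, inverted_spinor2, p', q', c1, c2, darboux_c1, darboux_c2;
      rewrite <- dot_planar; [reflexivity | |];
      rewrite Cdiv_conj, ?Cplus_conj, ?Cminus_conj, ?Cmult_conj, ?Copp_conj, ?Cconj_conj, ?RtoC_conj by apply Nc;
      field; apply Nc. }
  clear H1 H2 M.
  assert (Fac := wirtinger_conj _ _ _ Fa). assert (Fbc := wirtinger_conj _ _ _ Fb).
  split; [split|].
  - eexists. eapply wirtinger_ext; [| | |
      apply wirtinger_plus; [exact Fp | apply wirtinger_plus;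
        apply (wirtinger_scal (RtoC (-1))); apply wirtinger_mult;
        [exact G1 | exact Fa | exact G2 | exact Fbc]]]; intros z; cbv beta; try reflexivity.
    + rewrite RtoC_m1. unfold p'. ring.
    + rewrite inverted_potential_correct by apply N.
      rewrite RtoC_m1, Copp_conj, Cmult_conj, RtoC_conj. unfold q'. ring.
  - eexists. eapply wirtinger_ext; [| | |
      apply wirtinger_plus; [exact Fq | apply wirtinger_plus;
        [apply (wirtinger_scal (RtoC (-1))); apply wirtinger_mult;
        [exact G1 | exact Fb] | apply wirtinger_mult; [exact G2 | exact Fac]]]];
      intros z; cbv beta; try reflexivity.
    + rewrite RtoC_m1. unfold q'. ring.
    + rewrite inverted_potential_correct by apply N.
      (* The second equation yields a correction that looks different but is the same real
         function. *)
      replace (inverted_spinor2 (Y z) (a z) (b z) * a z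
            + Cconj (inverted_spinor1 (Y z) (a z) (b z)) * Cconj (b z))%C
       with (inverted_spinor1 (Y z) (a z) (b z) * b z
            + Cconj (inverted_spinor2 (Y z) (a z) (b z)) * Cconj (a z))%C.
      * rewrite RtoC_m1, Cmult_conj, RtoC_conj. unfold p'. ring.
      * unfold inverted_spinor1, inverted_spinor2.
        rewrite !Cdiv_conj, ?Cplus_conj, ?Cminus_conj, ?Cmult_conj, ?Copp_conj, ?Cconj_conj, ?RtoC_conj by apply Nc.
        field. apply Nc.
  - intros Z z w. split.
    + apply wirtinger_constant. apply wirtinger_ext with (4 := G1); intros y; try reflexivity.
      * rewrite (proj2 (Z y)). ring.
      * rewrite (proj1 (Z y)). ring.
    + apply wirtinger_constant. apply wirtinger_ext with (4 := G2); intros y; try reflexivity.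
      * rewrite (proj2 (Z y)). ring.
      * rewrite (proj1 (Z y)). ring.
Qed.

Lemma weierstrass_mirror_inversion (Y : C -> R3) (U : C -> R) (a b : C -> C) :
  weierstrass Y U a b -> (forall z, dot (Y z) (Y z) <> 0) ->
  weierstrass (fun z => mirror_inversion (Y z)) (inverted_potential Y U a b)
    (fun z => inverted_spinor1 (Y z) (a z) (b z)) (fun z => inverted_spinor2 (Y z) (a z) (b z)).
Proof.
  intros W N.
  assert (Nc : forall z, RtoC (dot (Y z) (Y z)) <> RtoC 0).
  { intros z H. apply (N z). exact (f_equal fst H). }
  split.
  (* The zero solution admits any constant [F]; with F = (-1, 0) its transform is the first column
     of [(Psi, j Psi) S^-1]. *)
  - destruct (darboux_transform Y U a b (fun _ => RtoC 0) (fun _ => RtoC 0)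
      (fun _ => RtoC (-1)) (fun _ => RtoC 0) W N) as [S _].
    + split; eexists; (eapply wirtinger_ext; [| | | apply (wirtinger_const (RtoC 0))]);
        intros z; cbv beta; try reflexivity; ring.
    + eapply wirtinger_ext; [| | | apply (wirtinger_const (RtoC (-1)))];
        intros z; cbv beta; try reflexivity; ring.
    + eapply wirtinger_ext; [| | | apply (wirtinger_const (RtoC 0))];
        intros z; cbv beta; try reflexivity; ring.
    + apply spinor_ext with (4 := S); intros z; try reflexivity;
        unfold inverted_spinor1, inverted_spinor2, darboux_c1, darboux_c2;
        rewrite RtoC_m1; field; apply Nc.
  - destruct W as (_ & K & T).
    assert (Kc := wirtinger_conj _ _ _ K).
    assert (Hn : wirtinger (fun z => RtoC (dot (Y z) (Y z)))
       (fun z => - RtoC 2 * RtoC (x3 (Y z)) * (b z * Cconj (a z)) - b z * b z * Cconj (planar (Y z))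
                   + planar (Y z) * (Cconj (a z) * Cconj (a z)))%C
       (fun z => - RtoC 2 * RtoC (x3 (Y z)) * (a z * Cconj (b z)) + a z * a z * Cconj (planar (Y z))
                   - planar (Y z) * (Cconj (b z) * Cconj (b z)))%C).
    { eapply wirtinger_ext; [| | | apply wirtinger_plus;
        [apply wirtinger_mult; [exact T | exact T] | apply wirtinger_mult; [exact K | exact Kc]]];
      intros z; cbv beta; rewrite ?dot_planar, ?Copp_conj, ?Cmult_conj; ring. }
    assert (Hi := wirtinger_inv _ _ _ Nc Hn).
    split.
    (* In the planar coordinate the mirrored inversion is k -> - conj k / |Y|^2, so the quotient
       rule gives its derivatives. *)
    + eapply wirtinger_ext; [| | | apply wirtinger_mult;
        [apply (wirtinger_scal (RtoC (-1))), Kc | exact Hi]]; intros z; cbv beta.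
      * generalize (N z). unfold mirror_inversion. destruct (Y z) as [y1 y2 y3]. unfold dot; cbn [x1 x2 x3].
        intros N'. apply injective_projections; simpl; field; exact N'.
      * unfold inverted_spinor2. rewrite RtoC_m1, ?Copp_conj, ?Cmult_conj.
        rewrite dot_planar. field. rewrite <- dot_planar. apply Nc.
      * unfold inverted_spinor1. rewrite RtoC_m1, ?Copp_conj, ?Cmult_conj.
        rewrite dot_planar. field. rewrite <- dot_planar. apply Nc.
    + eapply wirtinger_ext; [| | | apply wirtinger_mult; [exact T | exact Hi]]; intros z; cbv beta.
      * generalize (N z). unfold mirror_inversion. destruct (Y z) as [y1 y2 y3]. unfold dot; cbn [x1 x2 x3].
        intros N'. apply injective_projections; simpl; field; exact N'.
      * unfold inverted_spinor1, inverted_spinor2.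
        rewrite !Cdiv_conj, ?Cplus_conj, ?Cminus_conj, ?Cmult_conj, ?Copp_conj, ?Cconj_conj, ?RtoC_conj by apply Nc.
        rewrite dot_planar. field. rewrite <- dot_planar. apply Nc.
      * unfold inverted_spinor1, inverted_spinor2.
        rewrite !Cdiv_conj, ?Cplus_conj, ?Cminus_conj, ?Cmult_conj, ?Copp_conj, ?Cconj_conj, ?RtoC_conj by apply Nc.
        rewrite dot_planar. field. rewrite <- dot_planar. apply Nc.
Qed.

(** * Multipliers of the Weierstrass spinor and of primitives *)

Lemma Cmult_eq_0 (x y : C) : (x * y)%C = RtoC 0 -> x = RtoC 0 \/ y = RtoC 0.
Proof.
  intros H. destruct (Ceq_dec x (RtoC 0)) as [|Hx]; [now left|].
  destruct (Ceq_dec y (RtoC 0)) as [|Hy]; [now right|].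
  now destruct (Cmult_neq_0 x y Hx Hy).
Qed.

Lemma Csqr_eq (x y : C) : (x * x = y * y)%C -> x = y \/ x = (- y)%C.
Proof.
  intros H. destruct (Cmult_eq_0 (x - y) (x + y))%C as [E|E].
  - replace ((x - y) * (x + y))%C with (x * x - y * y)%C by ring. rewrite H. ring.
  - left. now apply Cminus_eq.
  - right. apply Cminus_eq. rewrite <- E. ring.
Qed.

(** The intermediate value theorem on the segment from [p] to [q]. *)
Lemma C1R_constant_sign (g gx gy : R * R -> R) (p q : R * R) :
  C1R g gx gy -> (forall r, g r <> 0) -> 0 < g p -> 0 < g q.
Proof.
  intros G N Hp. destruct (Rlt_or_le 0 (g q)) as [|Hq]; [assumption|].
  set (v := (fst q - fst p, snd q - snd p)).
  set (h := fun s : R => g (fst p + s * fst v, snd p + s * snd v)).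
  assert (h0 : h 0 = g p).
  { unfold h. rewrite !Rmult_0_l, !Rplus_0_r. now destruct p. }
  assert (h1 : h 1 = g q).
  { unfold h, v; cbn [fst snd]. destruct p, q; cbn [fst snd]. f_equal. f_equal; ring. }
  destruct (IVT_gen h 0 1 0) as (s & _ & Hs).
  - intros s. apply continuity_pt_filterlim. unfold h. apply continuous_segment.
    intros r. apply (C1R_continuous _ _ _ r G).
  - rewrite h0, h1. rewrite Rmin_right, Rmax_left; lra.
  - now destruct (N _ Hs).
Qed.

(** The squares fix each component up to sign, and the mixed product forces the two signs to agree.
    If [a] vanishes, the sign of [b] serves for both. *)
Lemma spinor_pm (a b a' b' : C) :
  0 < spinor_density a b -> (a' * a' = a * a)%C -> (b' * b' = b * b)%C ->
  (b' * Cconj a' = b * Cconj a)%C -> (a' = a /\ b' = b) \/ (a' = - a /\ b' = - b)%C.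
Proof.
  intros D Ea Eb E.
  destruct (Ceq_dec a (RtoC 0)) as [Ha|Ha].
  - assert (a' = RtoC 0).
    { subst a. destruct (Cmult_eq_0 a' a'); try assumption. rewrite Ea. ring. }
    subst a a'. destruct (Csqr_eq _ _ Eb) as [H|H]; [left | right]; split; trivial; ring.
  - assert (Hc : Cconj a <> RtoC 0).
    { intros H. apply Ha. rewrite <- (Cconj_conj a), H. apply RtoC_conj. }
    assert (R : forall x y : C, (x * Cconj a = y * Cconj a)%C -> x = y).
    { intros x y H. apply Cminus_eq. destruct (Cmult_eq_0 (x - y) (Cconj a))%C as [G|G]; [|exact G|now destruct Hc].
      replace ((x - y) * Cconj a)%C with (x * Cconj a - y * Cconj a)%C by ring. rewrite H. ring. }
    destruct (Csqr_eq _ _ Ea) as [H|H]; subst a'; [left | right]; split; trivial; apply R.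
    + exact E.
    + rewrite Copp_conj in E. replace (- b * Cconj a)%C with (- (b * Cconj a))%C by ring.
      rewrite <- E. ring.
Qed.

(** At each point the shifted spinor is plus or minus the spinor. The real part [g] of their
    Hermitian product is then plus or minus the density, never zero, so by continuity the sign is
    the same everywhere. *)
Lemma spinor_shift_sign (a b Az Ab Bz Bb : C -> C) (c : C) :
  wirtinger a Az Ab -> wirtinger b Bz Bb ->
  (forall z, 0 < spinor_density (a z) (b z)) ->
  (forall z, a (z + c) * a (z + c) = a z * a z)%C ->
  (forall z, b (z + c) * b (z + c) = b z * b z)%C ->
  (forall z, b (z + c) * Cconj (a (z + c)) = b z * Cconj (a z))%C ->
  exists s : R, s * s = 1 /\ forall z, a (z + c)%C = (RtoC s * a z)%C /\ b (z + c)%C = (RtoC s * b z)%C.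
Proof.
  intros A B D Ea Eb E.
  assert (pm := fun z => spinor_pm _ _ _ _ (D z) (Ea z) (Eb z) (E z)).
  destruct (wirtinger_plus _ _ _ _ _ _
     (wirtinger_mult _ _ _ _ _ _ (wirtinger_shift _ _ _ c A) (wirtinger_conj _ _ _ A))
     (wirtinger_mult _ _ _ _ _ _ (wirtinger_shift _ _ _ c B) (wirtinger_conj _ _ _ B))) as [G _].
  set (g := fun z => Re (a (z + c) * Cconj (a z) + b (z + c) * Cconj (b z))%C) in *.
  assert (plus : forall z, a (z + c)%C = a z /\ b (z + c)%C = b z -> 0 < g z).
  { intros z [H1 H2]. unfold g. rewrite H1, H2. generalize (D z). unfold spinor_density.
    destruct (a z), (b z); unfold Re, Im; simpl; lra. }
  assert (minus : forall z, a (z + c)%C = (- a z)%C /\ b (z + c)%C = (- b z)%C -> g z < 0).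
  { intros z [H1 H2]. unfold g. rewrite H1, H2. generalize (D z). unfold spinor_density.
    destruct (a z), (b z); unfold Re, Im; simpl; lra. }
  assert (N : forall z, g z <> 0).
  { intros z. destruct (pm z) as [H|H]; [apply plus in H | apply minus in H]; lra. }
  destruct (pm (RtoC 0)) as [H0|H0].
  - exists 1. split; [ring|]. intros z. destruct (pm z) as [[-> ->]|H]; [split; ring|].
    exfalso. generalize (C1R_constant_sign g _ _ _ z G N (plus _ H0)) (minus _ H). lra.
  - exists (-1). split; [ring|]. intros z. rewrite RtoC_m1. destruct (pm z) as [H|[-> ->]]; [|split; ring].
    exfalso. generalize (C1R_constant_sign g _ _ _ (RtoC 0) G N (plus _ H)) (minus _ H0). lra.
Qed.

Lemma periodic_partials (f A B : C -> C) (c : C) :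
  wirtinger f A B -> (forall z, f (z + c)%C = f z) ->
  forall z, A (z + c)%C = A z /\ B (z + c)%C = B z.
Proof.
  intros F P z. apply (wirtinger_unique f (fun z => A (z + c)%C) (fun z => B (z + c)%C) A B); [|exact F].
  now apply wirtinger_ext with (4 := wirtinger_shift _ _ _ c F).
Qed.

(** The derivatives of a periodic surface are periodic, and they are the quadratic expressions in
    the spinor that determine it up to sign. *)
Lemma weierstrass_shift_sign (Y : C -> R3) (U : C -> R) (a b : C -> C) (c : C) :
  weierstrass Y U a b -> (forall z, 0 < spinor_density (a z) (b z)) ->
  (forall z, Y (z + c)%C = Y z) ->
  exists s : R, s * s = 1 /\ forall z, a (z + c)%C = (RtoC s * a z)%C /\ b (z + c)%C = (RtoC s * b z)%C.
Proof.
  intros ([[Pa Fa] [Qb Fb]] & K & T) D P.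
  assert (H1 := periodic_partials _ _ _ c K (fun z => f_equal planar (P z))).
  assert (H2 := periodic_partials _ _ _ c T (fun z => f_equal (fun v => RtoC (x3 v)) (P z))).
  assert (O : forall x y : C, (- x = - y -> x = y)%C).
  { intros x y H. replace x with (- - x)%C by ring. rewrite H. ring. }
  apply (spinor_shift_sign _ _ _ _ _ _ c Fa Fb D); intros z.
  - apply H1.
  - apply O, H1.
  - apply O, H2.
Qed.

(** A primitive of a form with multiplier [mu] is itself multiplied by [mu] up to additive constants
    [d1] and [d2]. A constant absorbs both as soon as one component of [mu] differs from 1. *)
Lemma quasi_primitive (tau : C) (mu : C * C) (f P Q : C -> C) :
  wirtinger f P Q -> quasi tau mu P -> quasi tau mu Q -> mu <> (RtoC 1, RtoC 1) ->
  exists c, quasi tau mu (fun z => f z + c)%C.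
Proof.
  intros F HP HQ N.
  assert (D1 := fun z => wirtinger_constant (fun z => f (z + 1) + - fst mu * f z)%C z (RtoC 0)).
  assert (D2 := fun z => wirtinger_constant (fun z => f (z + tau) + - snd mu * f z)%C z (RtoC 0)).
  set (d1 := (f (0 + 1) + - fst mu * f 0)%C) in *.
  set (d2 := (f (0 + tau) + - snd mu * f 0)%C) in *.
  assert (E1 : forall z, f (z + 1)%C = (fst mu * f z + d1)%C).
  { intros z. rewrite <- (D1 z); [ring|].
    apply wirtinger_ext with (4 := wirtinger_plus _ _ _ _ _ _ (wirtinger_shift _ _ _ (RtoC 1) F) (wirtinger_scal (- fst mu)%C _ _ _ F));
      intros y; try reflexivity; rewrite ?(proj1 (HP y)), ?(proj1 (HQ y)); ring. }
  assert (E2 : forall z, f (z + tau)%C = (snd mu * f z + d2)%C).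
  { intros z. rewrite <- (D2 z); [ring|].
    apply wirtinger_ext with (4 := wirtinger_plus _ _ _ _ _ _ (wirtinger_shift _ _ _ tau F) (wirtinger_scal (- snd mu)%C _ _ _ F));
      intros y; try reflexivity; rewrite ?(proj2 (HP y)), ?(proj2 (HQ y)); ring. }
  clearbody d1 d2. clear D1 D2.
  (* Both orders of the two shifts lead to the same point; this relation lets the constant found
     from one shift serve the other. *)
  assert (E : ((fst mu - 1) * d2 = (snd mu - 1) * d1)%C).
  { generalize (E1 (RtoC 0 + tau)%C) (E2 (RtoC 0 + 1)%C).
    replace (0 + tau + 1)%C with (0 + 1 + tau)%C by ring. intros ->.
    rewrite E1, E2. intros H. apply Cminus_eq.
    match type of H with ?x = ?y => transitivity (x - y)%C; [ring | rewrite H; ring] end. }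
  assert (N1 : forall m : C, m <> RtoC 1 -> (m - 1)%C <> RtoC 0).
  { intros m Hm H. apply Hm. now apply Cminus_eq. }
  destruct (Ceq_dec (fst mu) (RtoC 1)) as [M1|M1].
  - assert (M2 : snd mu <> RtoC 1).
    { intros M2. apply N. now apply injective_projections. }
    exists (d2 / (snd mu - 1))%C. intros z. rewrite E1, E2. split; [|field; auto].
    replace d1 with ((fst mu - 1) * d2 / (snd mu - 1))%C; [field; auto|].
    rewrite E. field; auto.
  - exists (d1 / (fst mu - 1))%C. intros z. rewrite E1, E2. split; [field; auto|].
    replace d2 with ((snd mu - 1) * d1 / (fst mu - 1))%C; [field; auto|].
    rewrite <- E. field; auto.
Qed.

Lemma inverted_spinor_density (v : R3) (a b : C) :
  dot v v <> 0 ->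
  spinor_density (inverted_spinor1 v a b) (inverted_spinor2 v a b) = spinor_density a b / dot v v.
Proof.
  unfold spinor_density, inverted_spinor1, inverted_spinor2. destruct v as [y1 y2 y3], a, b.
  unfold dot; simpl. intros N. field. exact N.
Qed.

Lemma dot_pos (v : R3) : dot v v <> 0 -> 0 < dot v v.
Proof. unfold dot. nra. Qed.

Lemma in_bloch_mirror_inversion (tau : C) (Y : C -> R3) (w : C * C) :
  (forall z, dot (Y z) (Y z) <> 0) ->
  in_bloch tau Y w -> in_bloch tau (fun z => mirror_inversion (Y z)) w.
Proof.
  intros N (P & U & a & b & W & D & N1 & N2 & p & q & S & [z0 Nz] & Mp & Mq).
  split; [intros z; now rewrite (proj1 (P z)), (proj2 (P z))|].
  exists (inverted_potential Y U a b), (fun z => inverted_spinor1 (Y z) (a z) (b z)),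
    (fun z => inverted_spinor2 (Y z) (a z) (b z)).
  assert (W' := weierstrass_mirror_inversion Y U a b W N).
  assert (D' : forall z, 0 < spinor_density (inverted_spinor1 (Y z) (a z) (b z)) (inverted_spinor2 (Y z) (a z) (b z))).
  { intros z. rewrite inverted_spinor_density by apply N.
    apply Rdiv_lt_0_compat; [apply D | apply dot_pos, N]. }
  split; [exact W'|]. split; [exact D'|]. split; [exact N1|]. split; [exact N2|].
  destruct (weierstrass_shift_sign Y U a b (RtoC 1) W D (fun z => proj1 (P z))) as (s1 & S1 & M1).
  destruct (weierstrass_shift_sign Y U a b tau W D (fun z => proj2 (P z))) as (s2 & S2 & M2).
  assert (C1 : (RtoC s1 * RtoC s1)%C = RtoC 1) by (rewrite <- RtoC_mult, S1; reflexivity).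
  assert (C2 : (RtoC s2 * RtoC s2)%C = RtoC 1) by (rewrite <- RtoC_mult, S2; reflexivity).
  assert (Ma1 : forall z, a (z + 1)%C = (RtoC s1 * a z)%C) by (intros; apply M1).
  assert (Mb1 : forall z, b (z + 1)%C = (RtoC s1 * b z)%C) by (intros; apply M1).
  assert (Ma2 : forall z, a (z + tau)%C = (RtoC s2 * a z)%C) by (intros; apply M2).
  assert (Mb2 : forall z, b (z + tau)%C = (RtoC s2 * b z)%C) by (intros; apply M2).
  assert (Mp1 : forall z, p (z + 1)%C = (fst w * p z)%C) by (intros; apply Mp).
  assert (Mq1 : forall z, q (z + 1)%C = (fst w * q z)%C) by (intros; apply Mq).
  assert (Mp2 : forall z, p (z + tau)%C = (snd w * p z)%C) by (intros; apply Mp).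
  assert (Mq2 : forall z, q (z + tau)%C = (snd w * q z)%C) by (intros; apply Mq).
  assert (PY1 : forall z, Y (z + 1)%C = Y z) by (intros; apply P).
  assert (PY2 : forall z, Y (z + tau)%C = Y z) by (intros; apply P).
  (* [mu] is the multiplier of the forms [omega (psi, Psi)] and [omega (psi, j Psi)]: the signs are
     real, so [j Psi] has the multiplier of [Psi]. As the signs square to 1, [mu] is trivial only if
     [w] equals them. *)
  set (mu := (fst w * RtoC s1, snd w * RtoC s2)%C).
  destruct (classic (mu = (RtoC 1, RtoC 1))) as [Mu|Mu].
  - (* [w] is the multiplier of [(a, b)] itself. *)
    assert (w1 : fst w = RtoC s1).
    { replace (fst w) with (fst mu * RtoC s1)%C; [rewrite Mu; cbn [fst]; ring|].
      unfold mu; cbn [fst]. rewrite <- Cmult_assoc, C1. ring. }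
    assert (w2 : snd w = RtoC s2).
    { replace (snd w) with (snd mu * RtoC s2)%C; [rewrite Mu; cbn [snd]; ring|].
      unfold mu; cbn [snd]. rewrite <- Cmult_assoc, C2. ring. }
    do 2 eexists. split; [exact (proj1 W')|]. split; [|split].
    + exists z0. intros [E1 E2]. generalize (D' z0). rewrite E1, E2. unfold spinor_density; simpl. lra.
    + intros z. unfold inverted_spinor1, Cdiv.
      rewrite PY1, PY2, Ma1, Mb1, Ma2, Mb2, !Cmult_conj, !RtoC_conj, w1, w2. split; ring.
    + intros z. unfold inverted_spinor2, Cdiv.
      rewrite PY1, PY2, Ma1, Mb1, Ma2, Mb2, !Cmult_conj, !RtoC_conj, w1, w2. split; ring.
  - assert (Nc : forall z, RtoC (dot (Y z) (Y z)) <> RtoC 0).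
    { intros z H. apply (N z). exact (f_equal fst H). }
    destruct (spinor_forms_closed U a b p q (proj1 W) S) as [[g1 G1] [g2 G2]].
    (* The integration constants are chosen so that [F] has multiplier [mu]; then [c1] and [c2] have
       it too, and their products with [Psi] and [j Psi] have multiplier [w]. *)
    destruct (quasi_primitive tau mu g1 _ _ G1) as [d1 Q1]; [| | exact Mu |].
    { intros z. rewrite Mq1, Mq2, Mb1, Mb2. unfold mu; cbn [fst snd]. split; ring. }
    { intros z. rewrite Mp1, Mp2, Ma1, Ma2. unfold mu; cbn [fst snd]. split; ring. }
    destruct (quasi_primitive tau mu g2 _ _ G2) as [d2 Q2]; [| | exact Mu |].
    { intros z. rewrite Mq1, Mq2, Ma1, Ma2, !Cmult_conj, !RtoC_conj. unfold mu; cbn [fst snd]. split; ring. }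
    { intros z. rewrite Mp1, Mp2, Mb1, Mb2, !Cmult_conj, !RtoC_conj. unfold mu; cbn [fst snd]. split; ring. }
    set (f1 := fun z => (g1 z + d1)%C) in *. set (f2 := fun z => (g2 z + d2)%C) in *.
    assert (F1 : wirtinger f1 (fun z => q z * b z)%C (fun z => - (p z * a z))%C).
    { apply wirtinger_ext with (4 := wirtinger_plus _ _ _ _ _ _ G1 (wirtinger_const d1));
        intros z; try reflexivity; ring. }
    assert (F2 : wirtinger f2 (fun z => - (q z * Cconj (a z)))%C (fun z => - (p z * Cconj (b z)))%C).
    { apply wirtinger_ext with (4 := wirtinger_plus _ _ _ _ _ _ G2 (wirtinger_const d2));
        intros z; try reflexivity; ring. }
    clearbody f1 f2. clear G1 G2 g1 g2.
    destruct (darboux_transform Y U a b p q f1 f2 W N S F1 F2) as [S' Z].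
    set (c1 := fun z => darboux_c1 (Y z) (f1 z) (f2 z)) in *.
    set (c2 := fun z => darboux_c2 (Y z) (f1 z) (f2 z)) in *.
    assert (Mc1 : quasi tau mu c1).
    { intros z. unfold c1, darboux_c1, Cdiv. rewrite PY1, PY2, (proj1 (Q1 z)), (proj2 (Q1 z)), (proj1 (Q2 z)), (proj2 (Q2 z)).
      split; ring. }
    assert (Mc2 : quasi tau mu c2).
    { intros z. unfold c2, darboux_c2, Cdiv. rewrite PY1, PY2, (proj1 (Q1 z)), (proj2 (Q1 z)), (proj1 (Q2 z)), (proj2 (Q2 z)).
      split; ring. }
    assert (X1 : forall x y : C, (fst mu * x * (RtoC s1 * y))%C = (fst w * (x * y))%C).
    { intros x y. unfold mu; cbn [fst].
      transitivity (fst w * (RtoC s1 * RtoC s1) * (x * y))%C; [ring | rewrite C1; ring]. }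
    assert (X2 : forall x y : C, (snd mu * x * (RtoC s2 * y))%C = (snd w * (x * y))%C).
    { intros x y. unfold mu; cbn [snd].
      transitivity (snd w * (RtoC s2 * RtoC s2) * (x * y))%C; [ring | rewrite C2; ring]. }
    exists (fun z => p z - c1 z * a z - c2 z * Cconj (b z))%C,
      (fun z => q z - c1 z * b z + c2 z * Cconj (a z))%C.
    split; [exact S'|]. split; [|split].
    (* If the image vanished, [psi] would be c1 Psi + c2 j Psi with constant coefficients, hence
       would have the sign multipliers of [Psi]; being non-zero at [z0], it would make [mu]
       trivial. *)
    + apply not_all_not_ex. intros Z'.
      assert (Z0 : forall z, (p z - c1 z * a z - c2 z * Cconj (b z))%C = RtoC 0 /\
                             (q z - c1 z * b z + c2 z * Cconj (a z))%C = RtoC 0).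
      { intros z. apply NNPP, Z'. }
      assert (K : forall z w, c1 z = c1 w /\ c2 z = c2 w) by exact (Z Z0). clear Z Z'.
      assert (Ep : forall z, p z = (c1 z0 * a z + c2 z0 * Cconj (b z))%C).
      { intros z. rewrite (proj1 (K z0 z)), (proj2 (K z0 z)). apply Cminus_eq.
        rewrite <- (proj1 (Z0 z)). ring. }
      assert (Eq : forall z, q z = (c1 z0 * b z - c2 z0 * Cconj (a z))%C).
      { intros z. rewrite (proj1 (K z0 z)), (proj2 (K z0 z)). apply Cminus_eq.
        rewrite <- (proj2 (Z0 z)). ring. }
      assert (Lp1 : ((fst w - RtoC s1) * p z0)%C = RtoC 0).
      { transitivity (p (z0 + 1) - RtoC s1 * p z0)%C; [rewrite Mp1; ring|].
        rewrite !Ep, Ma1, Mb1, Cmult_conj, RtoC_conj. ring. }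
      assert (Lq1 : ((fst w - RtoC s1) * q z0)%C = RtoC 0).
      { transitivity (q (z0 + 1) - RtoC s1 * q z0)%C; [rewrite Mq1; ring|].
        rewrite !Eq, Ma1, Mb1, Cmult_conj, RtoC_conj. ring. }
      assert (Lp2 : ((snd w - RtoC s2) * p z0)%C = RtoC 0).
      { transitivity (p (z0 + tau) - RtoC s2 * p z0)%C; [rewrite Mp2; ring|].
        rewrite !Ep, Ma2, Mb2, Cmult_conj, RtoC_conj. ring. }
      assert (Lq2 : ((snd w - RtoC s2) * q z0)%C = RtoC 0).
      { transitivity (q (z0 + tau) - RtoC s2 * q z0)%C; [rewrite Mq2; ring|].
        rewrite !Eq, Ma2, Mb2, Cmult_conj, RtoC_conj. ring. }
      apply Mu. unfold mu. apply injective_projections; cbn [fst snd].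
      * rewrite (Cminus_eq (fst w) (RtoC s1)); [exact C1|].
        destruct (Cmult_eq_0 _ _ Lp1) as [H|H]; [exact H|].
        destruct (Cmult_eq_0 _ _ Lq1) as [H'|H']; [exact H'|]. now destruct Nz.
      * rewrite (Cminus_eq (snd w) (RtoC s2)); [exact C2|].
        destruct (Cmult_eq_0 _ _ Lp2) as [H|H]; [exact H|].
        destruct (Cmult_eq_0 _ _ Lq2) as [H'|H']; [exact H'|]. now destruct Nz.
    + intros z. rewrite Mp1, Mp2, (proj1 (Mc1 z)), (proj2 (Mc1 z)), (proj1 (Mc2 z)), (proj2 (Mc2 z)),
        Ma1, Ma2, Mb1, Mb2, !Cmult_conj, !RtoC_conj, !X1, !X2. split; ring.
    + intros z. rewrite Mq1, Mq2, (proj1 (Mc1 z)), (proj2 (Mc1 z)), (proj1 (Mc2 z)), (proj2 (Mc2 z)),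
        Ma1, Ma2, Mb1, Mb2, !Cmult_conj, !RtoC_conj, !X1, !X2. split; ring.
Qed.

(** * Rotations and the conformal group *)

Lemma R3_eq (u v : R3) : x1 u = x1 v -> x2 u = x2 v -> x3 u = x3 v -> u = v.
Proof. destruct u, v; simpl. now intros -> -> ->. Qed.

Lemma dot_zero (v : R3) : dot v v = 0 -> v = zero3.
Proof. unfold dot. intros H. apply R3_eq; simpl; nra. Qed.

(** For orthonormal u, v and a unit vector w, |w - u x v|^2 = 2 - 2 det, which is zero. The other
    two formulas follow by cyclic permutation of the rows. *)
Lemma SO3_cofactors (r1 r2 r3 : R3) :
  is_SO3 r1 r2 r3 -> r3 = cross r1 r2 /\ r1 = cross r2 r3 /\ r2 = cross r3 r1.
Proof.
  assert (C : forall u v w, is_SO3 u v w -> w = cross u v).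
  { intros u v w (Huu & Hvv & Hww & Huv & Huw & Hvw & Hd).
    assert (E : dot (sub3 w (cross u v)) (sub3 w (cross u v)) = 0).
    { transitivity (dot w w - 2 * dot (cross u v) w + (dot u u * dot v v - dot u v * dot u v)).
      - unfold dot, sub3, cross; simpl; ring.
      - rewrite Huu, Hvv, Hww, Huv, Hd. ring. }
    apply dot_zero in E. unfold sub3, zero3 in E. injection E as E1 E2 E3.
    apply R3_eq; simpl; lra. }
  assert (P : forall u v w, is_SO3 u v w -> is_SO3 v w u).
  { intros u v w (Huu & Hvv & Hww & Huv & Huw & Hvw & Hd).
    unfold is_SO3. repeat split; try assumption;
      unfold dot, cross in *; simpl in *; lra. }
  intros H. split; [|split]; [apply C, H | apply C, P, H | apply C, P, P, H].
Qed.

(** Every entry equals its cofactor, so the products of columns are determinant expansions: the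
    determinant itself on the diagonal, and one with a repeated column off it. *)
Lemma SO3_transpose (r1 r2 r3 : R3) :
  is_SO3 r1 r2 r3 ->
  is_SO3 (mk3 (x1 r1) (x1 r2) (x1 r3)) (mk3 (x2 r1) (x2 r2) (x2 r3)) (mk3 (x3 r1) (x3 r2) (x3 r3)).
Proof.
  intros H. destruct (SO3_cofactors _ _ _ H) as (E3 & E1 & E2).
  destruct H as (_ & _ & _ & _ & _ & _ & D).
  destruct r1 as [a1 a2 a3], r2 as [b1 b2 b3], r3 as [c1 c2 c3].
  unfold cross in E1, E2, E3; simpl in E1, E2, E3.
  injection E1 as A1 A2 A3; injection E2 as B1 B2 B3; injection E3 as C1 C2 C3.
  unfold is_SO3, dot, cross in *; simpl in *.
  repeat split.
  - rewrite <- D. rewrite A1 at 2. rewrite B1 at 2. rewrite C1 at 2. ring.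
  - rewrite <- D. rewrite A2 at 2. rewrite B2 at 2. rewrite C2 at 2. ring.
  - rewrite <- D. rewrite A3 at 2. rewrite B3 at 2. rewrite C3 at 2. ring.
  - rewrite A1, B1, C1. ring.
  - rewrite A1, B1, C1. ring.
  - rewrite A2, B2, C2. ring.
  - lra.
Qed.

Lemma rotate_dot (r1 r2 r3 v : R3) :
  is_SO3 r1 r2 r3 -> dot (rotate3 r1 r2 r3 v) (rotate3 r1 r2 r3 v) = dot v v.
Proof.
  intros H. apply SO3_transpose in H.
  destruct r1 as [a1 a2 a3], r2 as [b1 b2 b3], r3 as [c1 c2 c3], v as [v1 v2 v3].
  unfold is_SO3, rotate3, dot in *; simpl in *.
  destruct H as (H11 & H22 & H33 & H12 & H13 & H23 & _).
  transitivity (v1 * v1 * (a1 * a1 + b1 * b1 + c1 * c1) + v2 * v2 * (a2 * a2 + b2 * b2 + c2 * c2)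
    + v3 * v3 * (a3 * a3 + b3 * b3 + c3 * c3) + 2 * v1 * v2 * (a1 * a2 + b1 * b2 + c1 * c2)
    + 2 * v1 * v3 * (a1 * a3 + b1 * b3 + c1 * c3) + 2 * v2 * v3 * (a2 * a3 + b2 * b3 + c2 * c3)).
  - ring.
  - rewrite H11, H22, H33, H12, H13, H23. ring.
Qed.

Lemma rotate_transpose (r1 r2 r3 v : R3) :
  is_SO3 r1 r2 r3 ->
  rotate3 r1 r2 r3 (rotate3 (mk3 (x1 r1) (x1 r2) (x1 r3)) (mk3 (x2 r1) (x2 r2) (x2 r3))
                            (mk3 (x3 r1) (x3 r2) (x3 r3)) v) = v.
Proof.
  destruct r1 as [a1 a2 a3], r2 as [b1 b2 b3], r3 as [c1 c2 c3], v as [v1 v2 v3].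
  unfold is_SO3, rotate3, dot; simpl.
  intros (H11 & H22 & H33 & H12 & H13 & H23 & _). f_equal.
  - transitivity (v1 * (a1 * a1 + a2 * a2 + a3 * a3) + v2 * (a1 * b1 + a2 * b2 + a3 * b3)
                  + v3 * (a1 * c1 + a2 * c2 + a3 * c3)); [ring|]. rewrite H11, H12, H13. ring.
  - transitivity (v1 * (a1 * b1 + a2 * b2 + a3 * b3) + v2 * (b1 * b1 + b2 * b2 + b3 * b3)
                  + v3 * (b1 * c1 + b2 * c2 + b3 * c3)); [ring|]. rewrite H22, H12, H23. ring.
  - transitivity (v1 * (a1 * c1 + a2 * c2 + a3 * c3) + v2 * (b1 * c1 + b2 * c2 + b3 * c3)
                  + v3 * (c1 * c1 + c2 * c2 + c3 * c3)); [ring|]. rewrite H33, H13, H23. ring.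
Qed.

(* The unit quaternion of a rotation, up to the factor [2 sqrt (1 + tr)]. *)
Lemma spin_rotation_SO3 (r1 r2 r3 : R3) :
  is_SO3 r1 r2 r3 ->
  let d := 1 + x1 r1 + x2 r2 + x3 r3 in
  let al : C := (d, x2 r1 - x1 r2) in
  let be : C := (x2 r3 - x3 r2, x1 r3 - x3 r1) in
  spinor_density al be = 4 * d /\
  forall v, spin_rotation al be v = scal3 (4 * d) (rotate3 r1 r2 r3 v).
Proof.
  intros H. assert (H' := SO3_transpose _ _ _ H). destruct (SO3_cofactors _ _ _ H) as (E3 & E1 & E2).
  destruct r1 as [a1 a2 a3], r2 as [b1 b2 b3], r3 as [c1 c2 c3].
  unfold cross in E1, E2, E3; simpl in E1, E2, E3.
  injection E1 as A1 A2 A3; injection E2 as B1 B2 B3; injection E3 as C1 C2 C3.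
  unfold is_SO3, cross, dot in H, H'; simpl in H, H'.
  destruct H as (H11 & H22 & H33 & H12 & H13 & H23 & _).
  destruct H' as (K11 & K22 & K33 & K12 & K13 & K23 & _).
  simpl.
  set (p := 1 + a1 + b2 + c3). set (q := a2 - b1). set (r := c2 - b3). set (s := c1 - a3).
  (* With al = p + i q and be = r + i s, the left-hand sides are the entries of the matrix of
     [spin_rotation al be]. Expanded, each identity is a linear consequence of the orthogonality and
     cofactor relations. *)
  assert (M11 : p * p - q * q + r * r - s * s = 4 * p * a1) by (unfold p, q, r, s; lra).
  assert (M12 : 2 * p * q - 2 * r * s = 4 * p * a2) by (unfold p, q, r, s; lra).
  assert (M13 : - 2 * (p * s + q * r) = 4 * p * a3) by (unfold p, q, r, s; lra).
  assert (M21 : - (2 * p * q + 2 * r * s) = 4 * p * b1) by (unfold p, q, r, s; lra).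
  assert (M22 : p * p - q * q - r * r + s * s = 4 * p * b2) by (unfold p, q, r, s; lra).
  assert (M23 : - 2 * (p * r - q * s) = 4 * p * b3) by (unfold p, q, r, s; lra).
  assert (M31 : - 2 * (q * r - p * s) = 4 * p * c1) by (unfold p, q, r, s; lra).
  assert (M32 : 2 * (p * r + q * s) = 4 * p * c2) by (unfold p, q, r, s; lra).
  assert (M33 : p * p + q * q - r * r - s * s = 4 * p * c3) by (unfold p, q, r, s; lra).
  split.
  - unfold spinor_density; simpl. unfold p, q, r, s; lra.
  - clearbody p q r s. intros [v1 v2 v3]. apply R3_eq; unfold rotate3, scal3, dot; simpl.
    + transitivity ((4 * p * a1) * v1 + (4 * p * a2) * v2 + (4 * p * a3) * v3); [|ring].
      rewrite <- M11, <- M12, <- M13. ring.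
    + transitivity ((4 * p * b1) * v1 + (4 * p * b2) * v2 + (4 * p * b3) * v3); [|ring].
      rewrite <- M21, <- M22, <- M23. ring.
    + transitivity ((4 * p * c1) * v1 + (4 * p * c2) * v2 + (4 * p * c3) * v3); [|ring].
      rewrite <- M31, <- M32, <- M33. ring.
Qed.

(** The quaternion yields the rotation scaled by its squared norm 4 (1 + tr), which is positive when
    the trace is not -1; a dilation removes the factor. *)
Lemma in_bloch_rotation_generic (tau : C) (Y : C -> R3) (w : C * C) (r1 r2 r3 : R3) :
  is_SO3 r1 r2 r3 -> 1 + x1 r1 + x2 r2 + x3 r3 <> 0 ->
  in_bloch tau Y w -> in_bloch tau (fun z => rotate3 r1 r2 r3 (Y z)) w.
Proof.
  intros H N B. destruct (spin_rotation_SO3 _ _ _ H) as [D E]. cbv zeta in D, E.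
  set (d := 1 + x1 r1 + x2 r2 + x3 r3) in *.
  assert (Hd : 0 < 4 * d).
  { rewrite <- D. assert (0 <= 4 * d) by (rewrite <- D; unfold spinor_density; nra).
    rewrite D. lra. }
  apply in_bloch_ext with (fun z => scal3 (/ (4 * d)) (scal3 (4 * d) (rotate3 r1 r2 r3 (Y z)))).
  - intros z. apply R3_eq; simpl; field; lra.
  - apply (in_bloch_dilation_pos tau (fun z => scal3 (4 * d) (rotate3 r1 r2 r3 (Y z)))).
    + now apply Rinv_0_lt_compat.
    + apply in_bloch_ext with (1 := fun z => E (Y z)). apply in_bloch_spin_rotation; [|exact B].
      rewrite D. exact Hd.
Qed.

Lemma in_bloch_rotation (tau : C) (Y : C -> R3) (w : C * C) (r1 r2 r3 : R3) :
  is_SO3 r1 r2 r3 -> in_bloch tau Y w -> in_bloch tau (fun z => rotate3 r1 r2 r3 (Y z)) w.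
Proof.
  intros H B.
  (* Half-turns about the coordinate axes permute the quaternion components up to sign. *)
  assert (S : forall e1 e2 al be, e1 * e1 = 1 -> e2 * e2 = 1 -> spinor_density al be = 1 ->
    (forall v, spin_rotation al be v = mk3 (e1 * x1 v) (e2 * x2 v) (e1 * e2 * x3 v)) ->
    1 + e1 * x1 r1 + e2 * x2 r2 + e1 * e2 * x3 r3 <> 0 ->
    in_bloch tau (fun z => rotate3 r1 r2 r3 (Y z)) w).
  { intros e1 e2 al be H1 H2 Hd E N.
    set (f := fun v => mk3 (e1 * x1 v) (e2 * x2 v) (e1 * e2 * x3 v)).
    assert (D : forall u v, dot (f u) (f v) = dot u v).
    { intros u v. unfold f, dot; simpl.
      transitivity ((e1 * e1) * (x1 u * x1 v) + (e2 * e2) * (x2 u * x2 v)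
                    + (e1 * e1) * (e2 * e2) * (x3 u * x3 v)); [ring|]. rewrite H1, H2. ring. }
    (* The rotation R is written as (R f) f, where the half-turn [f] is an involution and R f has
       trace different from -1. *)
    apply in_bloch_ext with (fun z => rotate3 (f r1) (f r2) (f r3) (spin_rotation al be (Y z))).
    { intros z. rewrite E. unfold rotate3. change (mk3 (e1 * x1 (Y z)) (e2 * x2 (Y z)) (e1 * e2 * x3 (Y z))) with (f (Y z)).
      now rewrite !D. }
    apply (in_bloch_rotation_generic tau (fun z => spin_rotation al be (Y z))).
    - destruct H as (K1 & K2 & K3 & K4 & K5 & K6 & K7). unfold is_SO3. rewrite !D.
      repeat split; try assumption. rewrite <- K7. unfold f, dot, cross; simpl.
      match goal with |- _ = ?y => transitivity ((e1 * e1) * (e2 * e2) * y) end; [ring|].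
      rewrite H1, H2. ring.
    - unfold f; simpl. exact N.
    - apply in_bloch_spin_rotation; [lra | exact B]. }
  (* The four candidates for 1 + tr add up to 4, so they cannot all vanish. *)
  destruct (Req_dec (1 + x1 r1 + x2 r2 + x3 r3) 0) as [N0|N0].
  2:{ now apply in_bloch_rotation_generic. }
  destruct (Req_dec (1 - x1 r1 - x2 r2 + x3 r3) 0) as [N1|N1].
  2:{ apply (S (-1) (-1) Ci (RtoC 0)); try ring; [unfold spinor_density; simpl; ring | |lra].
      intros v; apply R3_eq; simpl; unfold Re, Im; simpl; ring. }
  destruct (Req_dec (1 + x1 r1 - x2 r2 - x3 r3) 0) as [N2|N2].
  2:{ apply (S 1 (-1) (RtoC 0) (RtoC 1)); try ring; [unfold spinor_density; simpl; ring | |lra].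
      intros v; apply R3_eq; simpl; unfold Re, Im; simpl; ring. }
  apply (S (-1) 1 (RtoC 0) Ci); try ring; [unfold spinor_density; simpl; ring | |lra].
  intros v; apply R3_eq; simpl; unfold Re, Im; simpl; ring.
Qed.

Lemma in_bloch_inversion (tau : C) (Y : C -> R3) (w : C * C) (X0 : R3) :
  (forall z, dot (sub3 (Y z) X0) (sub3 (Y z) X0) <> 0) ->
  in_bloch tau Y w ->
  in_bloch tau (fun z => scal3 (/ dot (sub3 (Y z) X0) (sub3 (Y z) X0)) (sub3 (Y z) X0)) w.
Proof.
  intros N B.
  assert (B1 : in_bloch tau (fun z => sub3 (Y z) X0) w).
  { apply in_bloch_ext with (2 := in_bloch_translation tau Y w (scal3 (-1) X0) B).
    intros z. apply R3_eq; simpl; ring. }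
  apply in_bloch_mirror_inversion in B1; [|exact N].
  (* The mirror in the second coordinate is undone by the antipodal map followed by the half-turn
     about the second axis, whose quaternion is (0, i). *)
  apply in_bloch_antipode in B1.
  assert (D : 0 < spinor_density (RtoC 0) Ci) by (unfold spinor_density; simpl; lra).
  apply in_bloch_ext with (2 := in_bloch_spin_rotation _ _ _ _ _ D B1).
  intros z. apply R3_eq; simpl; unfold Re, Im; simpl; field; apply N.
Qed.

(** * Normal form of conformal transformations *)

Inductive similarity : (R3 -> R3) -> Prop :=
| sim_translation v : similarity (fun x => add3 x v)
| sim_rotation r1 r2 r3 : is_SO3 r1 r2 r3 -> similarity (rotate3 r1 r2 r3)
| sim_dilation k : k <> 0 -> similarity (scal3 k)
| sim_compose A B : similarity A -> similarity B -> similarity (fun x => A (B x)).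

Lemma in_bloch_similarity (A : R3 -> R3) (tau : C) (Y : C -> R3) (w : C * C) :
  similarity A -> in_bloch tau Y w -> in_bloch tau (fun z => A (Y z)) w.
Proof.
  intros H. revert Y. induction H as [v | r1 r2 r3 H | k Hk | A B _ IA _ IB]; intros Y HY.
  - now apply in_bloch_translation.
  - now apply in_bloch_rotation.
  - destruct (Rlt_or_le 0 k) as [P|P].
    + now apply in_bloch_dilation_pos.
    + apply in_bloch_antipode, (in_bloch_dilation_pos _ _ _ (- k)) in HY; [|lra].
      apply in_bloch_ext with (2 := HY). intros z. apply R3_eq; simpl; ring.
  - apply (IA (fun z => B (Y z))), IB, HY.
Qed.

Lemma similarity_inverse (A : R3 -> R3) :
  similarity A -> exists B, similarity B /\ (forall x, A (B x) = x) /\ (forall x, B (A x) = x).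
Proof.
  induction 1 as [v | r1 r2 r3 H | k Hk | A B _ (A' & SA & A1 & A2) _ (B' & SB & B1 & B2)].
  - exists (fun x => add3 x (scal3 (-1) v)). split; [apply sim_translation|].
    split; intros x; apply R3_eq; simpl; ring.
  - eexists. split; [apply sim_rotation, SO3_transpose, H|]. split; intros x.
    + now apply rotate_transpose.
    + assert (H' := SO3_transpose _ _ _ H).
      generalize (rotate_transpose _ _ _ x H'). simpl. now destruct r1, r2, r3.
  - exists (scal3 (/ k)). split; [apply sim_dilation; now apply Rinv_neq_0_compat|].
    split; intros x; apply R3_eq; simpl; field; assumption.
  - exists (fun x => B' (A' x)). split; [now apply sim_compose|].
    split; intros x; [now rewrite B1 | now rewrite A2].
Qed.

(** An inversion moves past a similarity: its center is pulled back to the preimage of [v],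
    rotations pass through unchanged, dilation factors are inverted, and translations are absorbed
    by the center. *)
Lemma similarity_inversion (A : R3 -> R3) :
  similarity A -> forall v, exists A' X0, similarity A' /\
    forall P, inversion v (fix_infinity A P) = fix_infinity A' (inversion X0 P).
Proof.
  induction 1 as [u | r1 r2 r3 H | k Hk | A B _ IA _ IB]; intros v.
  - exists (scal3 1), (sub3 v u). split; [apply sim_dilation; lra|].
    intros [x|]; simpl; [|f_equal; apply R3_eq; simpl; ring].
    replace (sub3 x (sub3 v u)) with (sub3 (add3 x u) v) by (apply R3_eq; simpl; ring).
    destruct Req_EM_T; simpl; [reflexivity|]. f_equal. apply R3_eq; simpl; ring.
  - set (t := rotate3 (mk3 (x1 r1) (x1 r2) (x1 r3)) (mk3 (x2 r1) (x2 r2) (x2 r3))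
                      (mk3 (x3 r1) (x3 r2) (x3 r3)) v).
    exists (rotate3 r1 r2 r3), t. split; [now apply sim_rotation|].
    intros [x|]; simpl; [|f_equal; apply R3_eq; unfold rotate3, dot; simpl; ring].
    assert (E : sub3 (rotate3 r1 r2 r3 x) v = rotate3 r1 r2 r3 (sub3 x t)).
    { transitivity (sub3 (rotate3 r1 r2 r3 x) (rotate3 r1 r2 r3 t)).
      - unfold t. now rewrite rotate_transpose.
      - apply R3_eq; unfold rotate3, dot; simpl; ring. }
    rewrite E, rotate_dot by exact H.
    destruct Req_EM_T; simpl; [reflexivity|]. f_equal. apply R3_eq; unfold rotate3, dot; simpl; ring.
  - exists (scal3 (/ k)), (scal3 (/ k) v). split; [apply sim_dilation; now apply Rinv_neq_0_compat|].
    intros [x|]; simpl; [|f_equal; apply R3_eq; simpl; ring].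
    set (y := sub3 x (scal3 (/ k) v)).
    replace (sub3 (scal3 k x) v) with (scal3 k y).
    2:{ apply R3_eq; simpl; field; exact Hk. }
    assert (D : dot (scal3 k y) (scal3 k y) = k * k * dot y y) by (unfold dot; simpl; ring).
    rewrite D. destruct (Req_EM_T (dot y y) 0) as [Z|Z].
    + rewrite Z, Rmult_0_r. destruct Req_EM_T as [_|F]; [reflexivity | now destruct F].
    + destruct Req_EM_T as [F|_].
      * apply Rmult_integral in F as [F|F]; [|easy]. apply Rmult_integral in F. tauto.
      * simpl. f_equal. apply R3_eq; simpl; field; auto.
  - destruct (IA v) as (A' & X1 & SA & EA). destruct (IB X1) as (B' & X2 & SB & EB).
    exists (fun x => A' (B' x)), X2. split; [now apply sim_compose|]. intros P.
    transitivity (inversion v (fix_infinity A (fix_infinity B P))); [now destruct P|].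
    rewrite EA, EB. now destruct (inversion X2 P).
Qed.

(** The rotation by pi about the line of [c]. Its matrix is symmetric, so the images of the basis
    vectors can be taken as rows. *)
Lemma half_turn (c : R3) :
  dot c c <> 0 ->
  exists A, similarity A /\ forall x, A x = sub3 (scal3 (2 * dot c x / dot c c) c) x.
Proof.
  intros N. set (r := fun e => sub3 (scal3 (2 * dot c e / dot c c) c) e).
  exists (rotate3 (r (mk3 1 0 0)) (r (mk3 0 1 0)) (r (mk3 0 0 1))). split.
  - apply sim_rotation. unfold r, is_SO3. destruct c as [c1 c2 c3]. unfold dot, cross in *; simpl in *.
    repeat split; field; exact N.
  - intros x. apply R3_eq; unfold r, rotate3, dot in *; simpl; field; exact N.
Qed.

Definition moebius (T : R3hat -> R3hat) : Prop :=
  (exists A, similarity A /\ forall P, T P = fix_infinity A P) \/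
  (exists A X0, similarity A /\ forall P, T P = fix_infinity A (inversion X0 P)).

(** An inversion does not add its center back, so its values are inverted with respect to the
    origin; inverting there leaves only the translation by [- u]. *)
Lemma inversion_zero_inversion (u : R3) (P : R3hat) :
  inversion zero3 (inversion u P) = fix_infinity (fun x => sub3 x u) P.
Proof.
  destruct P as [x|]; simpl.
  - set (y := sub3 x u). destruct (Req_EM_T (dot y y) 0) as [Z|Z]; simpl.
    + f_equal. symmetry. now apply dot_zero.
    + assert (D : dot (sub3 (scal3 (/ dot y y) y) zero3) (sub3 (scal3 (/ dot y y) y) zero3) = / dot y y).
      { unfold dot in *; simpl. field. exact Z. }
      rewrite D. destruct Req_EM_T as [F|_].
      * now apply Rinv_neq_0_compat in Z.
      * f_equal. rewrite Rinv_inv. apply R3_eq; simpl; field; exact Z.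
  - destruct Req_EM_T as [_|F]; [reflexivity|]. destruct F. unfold dot; simpl; ring.
Qed.

Lemma inversion_inversion (v u : R3) :
  moebius (fun P => inversion v (inversion u P)).
Proof.
  destruct (Req_dec (dot v v) 0) as [Z|Z].
  - apply dot_zero in Z. subst v. left.
    exists (fun x => add3 x (scal3 (-1) u)). split; [apply sim_translation|].
    intros P. rewrite inversion_zero_inversion. destruct P; simpl; f_equal. apply R3_eq; simpl; ring.
  - right. destruct (half_turn v Z) as (H & SH & EH).
    set (n := dot v v) in *.
    (* The pole u + v / n is the point that the inner inversion sends to [v], and - v / n is the
       image of infinity. The linear part - H / n is the reflection in the plane orthogonal to [v],
       scaled by 1 / n. *)
    exists (fun x => add3 (scal3 (- / n) (H x)) (scal3 (- / n) v)), (add3 u (scal3 (/ n) v)).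
    split.
    { apply (sim_compose (fun x => add3 x (scal3 (- / n) v)) (fun x => scal3 (- / n) (H x))).
      apply sim_translation. apply (sim_compose (scal3 (- / n)) H); [|exact SH].
      apply sim_dilation. apply Ropp_neq_0_compat. now apply Rinv_neq_0_compat. }
    assert (Hn : 0 < n) by now apply dot_pos.
    intros [x|]; simpl.
    + replace (sub3 x (add3 u (scal3 (/ n) v))) with (sub3 (sub3 x u) (scal3 (/ n) v)) by (apply R3_eq; simpl; ring).
      set (y := sub3 x u).
      destruct (Req_EM_T (dot y y) 0) as [Y|Y]; simpl.
      (* Here [x] is the inner center: it passes through infinity and must end at zero. *)
      * apply dot_zero in Y. rewrite Y. 
        assert (D : dot (sub3 zero3 (scal3 (/ n) v)) (sub3 zero3 (scal3 (/ n) v)) = / n).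
        { transitivity (/ n * / n * dot v v); [unfold dot; simpl; ring|]. fold n. field; lra. }
        rewrite D. destruct Req_EM_T as [F|_].
        { now apply Rinv_neq_0_compat in Z. }
        simpl. f_equal. rewrite EH, Rinv_inv.
        assert (D' : 2 * dot v (scal3 n (sub3 zero3 (scal3 (/ n) v))) / dot v v = -2).
        { transitivity (2 * (n * (- / n * dot v v)) / dot v v); [unfold dot; simpl; f_equal; ring|]. fold n. field; lra. }
        fold n in D'. rewrite D'. apply R3_eq; simpl; field; lra.
      * set (m := dot y y) in *. assert (Hm : 0 < m) by now apply dot_pos.
        set (y' := sub3 y (scal3 (/ n) v)).
        assert (E' : dot y' y' = m - 2 * dot v y / n + / n).
        { transitivity (dot y y - 2 * dot v y * / n + / n * / n * dot v v); [unfold y', dot; simpl; ring|].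
          fold n m. field; lra. }
        assert (D : dot (sub3 (scal3 (/ m) y) v) (sub3 (scal3 (/ m) y) v) = n * / m * dot y' y').
        { rewrite E'. transitivity (/ m * / m * dot y y - 2 * / m * dot v y + dot v v);
            [unfold dot; simpl; ring|]. fold n m. field; lra. }
        rewrite D. destruct (Req_EM_T (dot y' y') 0) as [F|F].
        { rewrite F, Rmult_0_r. destruct Req_EM_T as [_|G]; [reflexivity | now destruct G]. }
        assert (Pos := dot_pos _ F).
        destruct Req_EM_T as [G|_].
        { exfalso. assert (0 < / m) by now apply Rinv_0_lt_compat.
          assert (0 < n * / m * dot y' y') by (repeat apply Rmult_lt_0_compat; assumption). lra. }
        simpl. f_equal. rewrite EH. fold n.
        assert (Dv : dot v (scal3 (/ dot y' y') y') = (dot v y - 1) / dot y' y').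
        { transitivity (/ dot y' y' * (dot v y - / n * dot v v)); [unfold y', dot; simpl; ring|].
          fold n. field; lra. }
        rewrite Dv. clear D Dv.
        set (s := dot v y) in *. set (l := dot y' y') in *.
        assert (Hl : l * n = m * n - 2 * s + 1) by (rewrite E'; field; lra).
        clearbody l s m n. unfold y'. clear y'. clearbody y.
        (* One coordinate of the claim, with [a] and [b] standing for the coordinates of [y] and
           [v]; [Hl] is the expansion of |y - v / n|^2 times [n]. *)
        assert (X : forall a b : R, / (n * / m * l) * (/ m * a - b) =
          - / n * (2 * ((s - 1) / l) / n * b - / l * (a - / n * b)) + - / n * b).
        { intros a b. apply Rmult_eq_reg_r with (n * n * l); [|repeat apply Rmult_integral_contrapositive_currified; lra].
          transitivity (n * a - n * m * b); [field; lra|].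
          transitivity (- 2 * (s - 1) * b + n * a - b - (l * n) * b); [|field; lra].
          rewrite Hl. ring. }
        apply R3_eq; simpl; apply X.
    + assert (D : dot (sub3 zero3 v) (sub3 zero3 v) = n) by (unfold n, dot; simpl; ring).
      rewrite D. destruct Req_EM_T as [F|_]; [easy|]. f_equal. rewrite EH. apply R3_eq; unfold dot; simpl; fold n; field; lra.
Qed.

Lemma moebius_ext (S T : R3hat -> R3hat) : (forall P, S P = T P) -> moebius S -> moebius T.
Proof.
  intros E [(A & SA & H) | (A & X0 & SA & H)]; [left; exists A | right; exists A, X0];
    (split; [exact SA | intros P; now rewrite <- E]).
Qed.

Lemma moebius_similarity (A : R3 -> R3) (T : R3hat -> R3hat) :
  similarity A -> moebius T -> moebius (fun P => fix_infinity A (T P)).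
Proof.
  intros SA [(B & SB & H) | (B & X0 & SB & H)].
  - left. exists (fun x => A (B x)). split; [now apply sim_compose|]. intros P. rewrite H. now destruct P.
  - right. exists (fun x => A (B x)), X0. split; [now apply sim_compose|]. intros P. rewrite H.
    now destruct (inversion X0 P).
Qed.

(** The new inversion is moved past the similarity; if it then meets another inversion,
    [inversion_inversion] reduces the pair to at most one. *)
Lemma moebius_inversion (v : R3) (T : R3hat -> R3hat) :
  moebius T -> moebius (fun P => inversion v (T P)).
Proof.
  intros [(B & SB & H) | (B & X0 & SB & H)]; destruct (similarity_inversion B SB v) as (A & X1 & SA & E).
  - right. exists A, X1. split; [exact SA|]. intros P. now rewrite H, E.
  - apply moebius_ext with (fun P => fix_infinity A (inversion X1 (inversion X0 P))).
    + intros P. now rewrite H, E.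
    + apply moebius_similarity; [exact SA | apply inversion_inversion].
Qed.

Lemma moebius_compose (S T : R3hat -> R3hat) : moebius S -> moebius T -> moebius (fun P => S (T P)).
Proof.
  intros [(A & SA & H) | (A & X0 & SA & H)] HT.
  - apply moebius_ext with (fun P => fix_infinity A (T P)); [intros P; now rewrite H|].
    now apply moebius_similarity.
  - apply moebius_ext with (fun P => fix_infinity A (inversion X0 (T P))); [intros P; now rewrite H|].
    now apply moebius_similarity, moebius_inversion.
Qed.

Lemma fix_infinity_cancel (A B : R3 -> R3) (P : R3hat) :
  (forall x, A (B x) = x) -> fix_infinity A (fix_infinity B P) = P.
Proof. intros H. destruct P; simpl; [now rewrite H | reflexivity]. Qed.

Lemma moebius_inverse (T : R3hat -> R3hat) :
  moebius T -> exists S, moebius S /\ (forall P, S (T P) = P) /\ (forall P, T (S P) = P).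
Proof.
  intros [(A & SA & H) | (A & X0 & SA & H)];
    destruct (similarity_inverse A SA) as (B & SB & AB & BA).
  - exists (fix_infinity B). split; [left; now exists B|].
    split; intros P; rewrite H; now apply fix_infinity_cancel.
  (* After undoing [A], the inversion at the origin recovers the point up to translation by the
     center. *)
  - exists (fun P => fix_infinity (fun x => add3 x X0) (inversion zero3 (fix_infinity B P))).
    split; [|split].
    + apply moebius_similarity; [apply sim_translation|]. apply moebius_inversion. left. now exists B.
    + intros P. rewrite H, (fix_infinity_cancel B A) by exact BA. rewrite inversion_zero_inversion.
      apply fix_infinity_cancel. intros x. apply R3_eq; simpl; ring.
    + intros P. rewrite H.
      assert (E : forall Q, inversion X0 (fix_infinity (fun x => add3 x X0) Q) = inversion zero3 Q).
      { intros [x|]; simpl; [|reflexivity].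
        now replace (sub3 (add3 x X0) X0) with (sub3 x zero3) by (apply R3_eq; simpl; ring). }
      rewrite E, inversion_zero_inversion.
      replace (fix_infinity (fun x => sub3 x zero3) (fix_infinity B P)) with (fix_infinity B P).
      * now apply fix_infinity_cancel.
      * destruct P; simpl; f_equal. apply R3_eq; simpl; ring.
Qed.

Lemma conformal_moebius (T : R3hat -> R3hat) : conformal T -> moebius T.
Proof.
  induction 1 as [v | r1 r2 r3 H | k Hk | v Hv | X0 | S T _ IS _ IT | S T _ IT ST TS].
  - left. eexists. split; [apply sim_translation | reflexivity].
  - left. eexists. split; [apply sim_rotation, H | reflexivity].
  - left. eexists. split; [apply sim_dilation, Hk | reflexivity].
  (* A reflection is -1 times the half-turn about its normal. *)
  - left. destruct (half_turn v) as (A & SA & E); [lra|].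
    exists (fun x => scal3 (-1) (A x)). split.
    + apply sim_compose; [apply sim_dilation; lra | exact SA].
    + intros [x|]; simpl; f_equal. rewrite E, Hv. apply R3_eq; simpl; field.
  - right. exists (scal3 1), X0. split; [apply sim_dilation; lra|].
    intros P. destruct (inversion X0 P); simpl; f_equal. apply R3_eq; simpl; ring.
  - now apply moebius_compose.
  - destruct (moebius_inverse T IT) as (S' & HS & E1 & E2).
    apply moebius_ext with S'; [|exact HS]. intros P. rewrite <- (TS P) at 1. apply E1.
Qed.

(** * Invariance of the Bloch variety *)

Lemma in_bloch_moebius (T : R3hat -> R3hat) (tau : C) (Y : C -> R3) (Y' : C -> R3) (w : C * C) :
  moebius T -> (forall z, T (Some (Y z)) = Some (Y' z)) -> in_bloch tau Y w -> in_bloch tau Y' w.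
Proof.
  intros [(A & SA & H) | (A & X0 & SA & H)] E B.
  - apply in_bloch_ext with (fun z => A (Y z)).
    + intros z. generalize (E z). rewrite H. simpl. now intros [= ->].
    + now apply in_bloch_similarity.
  (* Finiteness of the image keeps the center of the inversion off the surface. *)
  - assert (K : forall z, dot (sub3 (Y z) X0) (sub3 (Y z) X0) <> 0 /\
      A (scal3 (/ dot (sub3 (Y z) X0) (sub3 (Y z) X0)) (sub3 (Y z) X0)) = Y' z).
    { intros z. generalize (E z). rewrite H. simpl. destruct Req_EM_T as [Z|Z]; [discriminate|].
      simpl. intros [= ->]. now split. }
    apply in_bloch_ext with (1 := fun z => proj2 (K z)).
    apply (in_bloch_similarity A); [exact SA|]. apply in_bloch_inversion; [apply K | exact B].
Qed.

(** The conformal coordinate of [X] also serves [X']: the new Weierstrass representation shows that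
    the metric is still conformal, with the squared density of the new spinor as its factor. *)
Lemma bloch_variety_moebius (a b : R * R) (X X' : R * R -> R3) (T : R3hat -> R3hat) (w : C * C) :
  (forall p, X (shift a p) = X p) -> (forall p, X (shift b p) = X p) ->
  moebius T -> (forall p, T (Some (X p)) = Some (X' p)) ->
  bloch_variety a b X w -> bloch_variety a b X' w.
Proof.
  intros Pa Pb HT E (tau & z & zi & U & (Z1 & Z2 & Z3 & Z4 & Z5 & Z6 & Z7 & f & F) & HU & HB).
  apply is_potential_weierstrass in HU as (al & be & W).
  assert (B : in_bloch tau (fun q => X (zi q)) w).
  { split.
    - intros q. split.
      + rewrite <- (Pa (zi q)). f_equal. rewrite <- (Z3 (shift a (zi q))). now rewrite Z6, Z4.
      + rewrite <- (Pb (zi q)). f_equal. rewrite <- (Z3 (shift b (zi q))). now rewrite Z7, Z4.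
    - exists U, al, be. split; [exact W|]. split; [|now apply bloch_variety_potential_spectrum].
      intros q. destruct (F q) as (F0 & F1 & _). destruct (weierstrass_metric _ _ _ _ q W) as (M & _).
      assert (M' : f q = spinor_density (al q) (be q) * spinor_density (al q) (be q))
        by (rewrite <- F1; exact M).
      assert (0 <= spinor_density (al q) (be q)) by (unfold spinor_density; nra).
      nra. }
  apply (in_bloch_moebius T tau _ (fun q => X' (zi q))) in B; [|exact HT | intros q; apply E].
  destruct B as (_ & U' & al' & be' & W' & D & B').
  exists tau, z, zi, U'. split; [|split].
  - repeat (split; [assumption|]).
    exists (fun q => spinor_density (al' q) (be' q) * spinor_density (al' q) (be' q)).
    intros q. split; [|exact (weierstrass_metric _ _ _ _ q W')].
    apply Rmult_lt_0_compat; apply D.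
  - apply is_potential_weierstrass. now exists al', be'.
  - now apply bloch_variety_potential_spectrum.
Qed.

Theorem theorem1 :
  forall (a b : R * R) (X : R * R -> R3) (T : R3hat -> R3hat),
    independent a b ->
    torus_immersion a b X ->
    conformal T ->
    (forall p : R * R, T (Some (X p)) <> None) ->
    forall w : C * C,
      bloch_variety a b (compose3 T X) w <-> bloch_variety a b X w.
Proof.
  intros a b X T _ (Pa & Pb & _) HT N w. apply conformal_moebius in HT.
  assert (E : forall p, T (Some (X p)) = Some (compose3 T X p)).
  { intros p. unfold compose3. specialize (N p). now destruct (T (Some (X p))). }
  split.
  (* The other inclusion is the same transport along the inverse map, which sends the transformed
     surface back to [X]. *)
  - destruct (moebius_inverse T HT) as (S & HS & ST & _).
    apply (bloch_variety_moebius a b (compose3 T X) X S); [| | exact HS |].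
    + intros p. unfold compose3. now rewrite Pa.
    + intros p. unfold compose3. now rewrite Pb.
    + intros p. now rewrite <- E, ST.
  - now apply (bloch_variety_moebius a b X (compose3 T X) T).
Qed.
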